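(* Let $J$ be a non-infinitesimal interval of ${}^\bullet\mathbb{R}$ and let $f:J\to{}^\bullet\mathbb{R}$ be a smooth function such that $f'(x)=0$ for every $x\in\mathrm{int}(J)$. Then $f$ is constant on $J$.
   Context: Fermat reals: let $\mathbb{R}_o[t]$ be the set of maps $x:\mathbb{R}_{\ge0}\to\mathbb{R}$, $t\mapsto x_t$, of the form $x_t=r+\sum_{i=1}^k\alpha_i t^{a_i}+o(t)$ as $t\to0^+$, with $k\in\mathbb{N}$, $r,\alpha_i\in\mathbb{R}$, $a_i\in\mathbb{R}_{\ge0}$. Write $x\sim y$ iff $x_t=y_t+o(t)$ as $t\to0^+$. The ring of Fermat reals is ${}^\bullet\mathbb{R}:=\mathbb{R}_o[t]/\sim$ with pointwise operations; $\mathbb{R}\subseteq{}^\bullet\mathbb{R}$ via constants. The standard part of $x=[x_t]$ is ${}^\circ x:=x_0$ (componentwise on ${}^\bullet\mathbb{R}^n$). ${}^\bullet\mathbb{R}$ is totally ordered by: $x\le y$ iff for representatives there is $z\in\mathbb{R}_o[t]$ with $z\sim0$ and $x_t\le y_t+z_t$ for all small $t\ge0$. Let $\overline{{}^\bullet\mathbb{R}}:={}^\bullet\mathbb{R}\cup\{\pm\infty\}$, ${}^\circ(\pm\infty):=\pm\infty$. An interval is a set $[a,b],(a,b),[a,b),(a,b]$ of points of ${}^\bullet\mathbb{R}$ with $a\le b$ in $\overline{{}^\bullet\mathbb{R}}$; it is non-infinitesimal if ${}^\circ a<{}^\circ b$. The Fermat topology on ${}^\bullet\mathbb{R}^n$ has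 open sets ${}^\bullet V:=\{x:{}^\circ x\in V\}$, $V\subseteq\mathbb{R}^n$ open; $\mathrm{int}(J)=\{x:{}^\circ a<{}^\circ x<{}^\circ b\}$ is the interior in this topology. For $\alpha\in C^\infty(W,\mathbb{R}^m)$, $W\subseteq\mathbb{R}^d$ open, ${}^\bullet\alpha:{}^\bullet W\to{}^\bullet\mathbb{R}^m$, ${}^\bullet\alpha([x_t]):=[\alpha(x_t)]$. A map $f:S\to{}^\bullet\mathbb{R}^m$, $S\subseteq{}^\bullet\mathbb{R}^n$, is smooth (quasi-standard smooth) if for every $x\in S$ there exist open $V\subseteq\mathbb{R}^n$ with $x\in{}^\bullet V$, open $P\subseteq\mathbb{R}^{\mathsf p}$, $p\in{}^\bullet P$ and $\alpha\in C^\infty(P\times V,\mathbb{R}^m)$ with $f(y)={}^\bullet\alpha(p,y)$ for all $y\in{}^\bullet V\cap S$. For $f:J\to{}^\bullet\mathbb{R}$ smooth on a non-infinitesimal interval and $x\in J$, the derivative is $f'(x):={}^\bullet(\partial_2\alpha)(p,x)$ for any such local representation of $f$ around $x$ (this does not depend on the representation; equivalently $f'(x)=r(x,0)$ where $r$ is the unique smooth function with $f(x+h)=f(x)+h\,r(x,h)$ for all sufficiently small $h$ with $x+h\in J$). *)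

(* Defs.v *)
From HB Require Import structures.
From mathcomp Require Import all_boot all_order all_algebra.
From mathcomp Require Import all_classical all_reals all_analysis.
Set Implicit Arguments.
Unset Strict Implicit.
Unset Printing Implicit Defensive.
Import Order.TTheory GRing.Theory Num.Theory.
Import numFieldNormedType.Exports.
Local Open Scope classical_set_scope.
Local Open Scope ring_scope.

Section FermatReals.
Variable R : realType.

Fixpoint Ck (V W : normedModType R) (k : nat) (U : set V) (f : V -> W) : Prop :=
  match k with
  | 0 => {in U, continuous f}
  | k'.+1 => (forall x, U x -> differentiable f x) /\
             (forall v : V, Ck k' U (fun x => 'D_v f x))
  end.

Definition smooth_on (V W : normedModType R) (U : set V) (f : V -> W) : Prop :=
  forall k, Ck k U f.

(* w = o(t) as t -> 0^+, for a map defined on R_{>=0} (values at t < 0 are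
   irrelevant): w_0 = 0 and w_t / t -> 0 as t -> 0^+. *)
Definition little_o_t (w : R -> R) : Prop :=
  w 0 = 0 /\ (fun t => w t / t) @ 0^'+ --> (0 : R).

Definition Ro (x : R -> R) : Prop :=
  exists (k : nat) (r : R) (alpha a : 'I_k -> R),
    (forall i, 0 <= a i) /\
    little_o_t (fun t => x t - (r + \sum_(i < k) alpha i * powR t (a i))).

Definition fsim (x y : R -> R) : Prop := little_o_t (fun t => x t - y t).

Definition FR : Type :=
  {C : set (R -> R) | exists x, Ro x /\ C = [set y | Ro y /\ fsim y x]}.

Definition repr_of (x : R -> R) (z : FR) : Prop := proj1_sig z x.

Definition FR_of (x : R -> R) (hx : Ro x) : FR :=
  exist _ [set y | Ro y /\ fsim y x] (ex_intro _ x (conj hx erefl)).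

Lemma Ro_const (r : R) : Ro (fun _ => r).
Proof.
exists 0%N, r, (fun _ => 0), (fun _ => 0); split; first by case.
rewrite /little_o_t /=; split; first by rewrite big_ord0 addr0 subrr.
have -> : (fun t : R => (r - (r + \sum_(i < 0) 0 * powR t 0)) / t) = fun _ => 0.
  by apply: funext => t; rewrite big_ord0 addr0 subrr mul0r.
exact: cvg_cst.
Qed.

Definition FRc (r : R) : FR := FR_of (Ro_const r).
Definition FR0 : FR := FRc 0.

Lemma FR_inhabited_class (z : FR) : exists x, repr_of x z.
Proof.
case: z => C [x [hx eC]]; exists x; rewrite /repr_of /= eC; split => //.
rewrite /fsim /little_o_t subrr; split => //.
have -> : (fun t : R => (x t - x t) / t) = fun _ => 0.
  by apply: funext => t; rewrite subrr mul0r.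
exact: cvg_cst.
Qed.

Definition rep (z : FR) : R -> R := proj1_sig (cid (FR_inhabited_class z)).
Definition st (z : FR) : R := rep z 0.

Definition st_vec (p : nat) (z : 'I_p -> FR) : 'rV[R]_p := \row_i st (z i).

Definition FR_le (x y : FR) : Prop :=
  exists (xr yr z : R -> R), repr_of xr x /\ repr_of yr y /\
    Ro z /\ fsim z (fun _ => 0) /\
    exists2 d : R, 0 < d & forall t, 0 <= t < d -> xr t <= yr t + z t.

Inductive eFR : Type := EFin of FR | EPinf | ENinf.

Definition eFR_le (a b : eFR) : Prop :=
  match a, b with
  | ENinf, _ => True
  | _, EPinf => True
  | EFin x, EFin y => FR_le x y
  | _, _ => False
  end.

Definition FR_lt (x y : FR) : Prop := FR_le x y /\ x <> y.

Definition lower_ok (a : eFR) (ca : bool) (x : FR) : Prop :=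
  match a with
  | ENinf => True
  | EPinf => False
  | EFin a' => if ca then FR_le a' x else FR_lt a' x
  end.

Definition upper_ok (b : eFR) (cb : bool) (x : FR) : Prop :=
  match b with
  | EPinf => True
  | ENinf => False
  | EFin b' => if cb then FR_le x b' else FR_lt x b'
  end.

Definition FR_interval (a b : eFR) (ca cb : bool) : set FR :=
  [set x | lower_ok a ca x /\ upper_ok b cb x].

Definition est (a : eFR) : \bar R :=
  match a with EFin x => (st x)%:E | EPinf => +oo%E | ENinf => -oo%E end.

(* interior of the interval in the Fermat topology *)
Definition FR_int (a b : eFR) : set FR :=
  [set x | (est a < (st x)%:E)%E /\ ((st x)%:E < est b)%E].

Definition ext_eq (p : nat) (alpha : 'rV[R]_p * R -> R)
    (pp : 'I_p -> FR) (y z : FR) : Prop :=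
  exists (pr : 'I_p -> R -> R) (yr : R -> R),
    (forall i, repr_of (pr i) (pp i)) /\ repr_of yr y /\
    repr_of (fun t => alpha (\row_i pr i t, yr t)) z.

Definition local_repr (S : set FR) (f : FR -> FR) (x : FR)
    (V : set R) (p : nat) (P : set 'rV[R]_p) (pp : 'I_p -> FR)
    (alpha : 'rV[R]_p * R -> R) : Prop :=
  open V /\ V (st x) /\ open P /\ P (st_vec pp) /\
  smooth_on (P `*` V) alpha /\
  (forall y, S y -> V (st y) -> ext_eq alpha pp y (f y)).

Definition FR_smooth (S : set FR) (f : FR -> FR) : Prop :=
  forall x, S x -> exists V p P pp alpha, @local_repr S f x V p P pp alpha.

Definition partial2 (p : nat) (alpha : 'rV[R]_p * R -> R) :
    'rV[R]_p * R -> R :=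
  fun u => 'D_((0 : 'rV[R]_p), (1 : R)) alpha u.

Definition is_FR_deriv (S : set FR) (f : FR -> FR) (x d : FR) : Prop :=
  exists V p P pp alpha,
    @local_repr S f x V p P pp alpha /\ ext_eq (partial2 alpha) pp x d.

(* f'(x) (independent of the representation by the paper's result) *)
Definition FR_deriv (S : set FR) (f : FR -> FR) (x : FR) : FR :=
  match pselect (exists d, is_FR_deriv S f x d) with
  | left h => proj1_sig (cid h)
  | right _ => FR0
  end.

End FermatReals.

(* Main.v *)
(* Write lo for o(t) as t -> 0+.  Expanding a smooth map g around a standard
   parameter p0, one gets, for z near a given real point,
     g(p_t, z) = sum_i T_i(t) W_i(z) + lo   uniformly in z,
   with finitely many T_i in R_o[t], linearly independent modulo lo, and smooth
   real functions W_i.  Independence turns pointwise statements modulo lo into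
   exact statements on the W_i.  Applied to g = d_2 alpha it shows that the
   derivative does not depend on the local representation, so that f' = 0 forces
   W_i = 0 on the standard points of int(J).  At an end point the W_i are then
   flat, which absorbs the nilpotent displacement z_t - z_0; the mean value
   theorem gives that f is locally constant, and J is connected. *)
Require Import Defs.
From mathcomp Require Import all_boot all_order all_algebra.
From mathcomp Require Import all_classical all_reals all_analysis.
From mathcomp Require Import ring lra.
Set Implicit Arguments.
Unset Strict Implicit.
Unset Printing Implicit Defensive.
Import Order.TTheory GRing.Theory Num.Theory.
Import numFieldNormedType.Exports.
Local Open Scope classical_set_scope.
Local Open Scope ring_scope.

(* MathComp's generic quotients shadow this name. *)
Local Notation repr_of := Defs.repr_of.

(** * Little-o and the ring of representatives *)

(** The obstacle is uniformity. The hypotheses give congruences modulo lo separately at each real z,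
    with rates that depend on z, so they cannot be differentiated or integrated in z; yet a mean
    value argument at fixed t needs a bound on a whole segment. Separating t from z leaves one
    common error and exact functions of z. The expansion is finite because the infinitesimal part of
    a Fermat real has a power that is lo, so Taylor expansion in the parameter stops. [FR_deriv] is
    a choice, so f' = 0 speaks of one unknown representation and has to be transported to the one at
    hand. Flatness is needed because an end point may have a nonzero infinitesimal part, as for a =
    [-t^(1/2)]: the segment from a_t to its standard part 0 then lies where nothing is known about
    the W_i beyond their derivatives at 0. *)

Section LittleO.
Context (R : realType).
Implicit Types (w v x y b : R -> R).

(** The limit half of [little_o_t]. Equality of values at 0 is recovered from right-continuity of
    elements of [Ro] ([lo_val0]), so congruences can be handled for t > 0 alone. *)
Definition lo w : Prop := (fun t => w t / t) @ 0^'+ --> (0 : R).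

Lemma loP w : lo w <-> forall e, 0 < e -> \forall t \near 0^'+, `|w t| <= e * t.
Proof.
split.
  move=> /cvgrPdist_le h e e0; have := h e e0.
  apply: filterS2 (nbhs_right_gt (0:R)) => t t0.
  rewrite sub0r normrN normrM normfV (gtr0_norm t0).
  by rewrite ler_pdivrMr.
move=> h; apply/cvgrPdist_le => e e0.
apply: filterS2 (nbhs_right_gt (0:R)) (h e e0) => t t0.
by rewrite sub0r normrN normrM normfV (gtr0_norm t0) ler_pdivrMr.
Qed.

Lemma lo_le w v : lo v -> (\forall t \near 0^'+, `|w t| <= `|v t|) -> lo w.
Proof.
move=> /loP hv wv; apply/loP => e e0.
by apply: filterS2 wv (hv e e0) => t; exact: le_trans.
Qed.

Lemma lo_eq w v : lo v -> (\forall t \near 0^'+, w t = v t) -> lo w.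
Proof. by move=> hv h; apply: lo_le hv _; apply: filterS h => t ->. Qed.

Lemma lo0 : lo (fun=> 0).
Proof. by apply/loP => e e0; near=> t; rewrite normr0 mulr_ge0// ltW.
Unshelve. all: by end_near. Qed.

Lemma loD w v : lo w -> lo v -> lo (fun t => w t + v t).
Proof.
rewrite /lo => hw hv; have -> : (fun t => (w t + v t) / t) = (fun t => w t / t) \+ (fun t => v t / t).
  by apply/funext => t /=; rewrite mulrDl.
have H := cvgD hw hv; rewrite addr0 in H; exact: H.
Qed.

Lemma loM w b C : lo w -> (\forall t \near 0^'+, `|b t| <= C) -> lo (fun t => w t * b t).
Proof.
move=> /loP hw hb; apply/loP => e e0.
have C0 : 0 < `|C| + 1 by rewrite ltr_wpDl.
apply: filterS2 hb (hw (e / (`|C| + 1)) _) => [t hb hw'|]; last exact: divr_gt0.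
rewrite normrM; apply: le_trans (ler_pM _ _ hw' (hb : _ <= C)) _ => //.
have t0 : 0 <= t.
  have: 0 <= e / (`|C| + 1) * t by exact: le_trans (normr_ge0 _) hw'.
  by rewrite pmulr_rge0// divr_gt0.
rewrite mulrAC [X in X <= _]mulrAC -[X in _ <= X]mulr1 -!mulrA ler_pM2l// mulrCA ler_wpM2l//.
rewrite mulrC ler_pdivrMr// mul1r; apply: le_trans (ler_norm _) _; lra.
Qed.

Lemma loZ w c : lo w -> lo (fun t => w t * c).
Proof. by move=> hw; apply: (@loM _ _ `|c|) hw _; apply: nearW. Qed.

Lemma loN w : lo w -> lo (fun t => - w t).
Proof. by move=> hw; apply: lo_le hw _; apply: nearW => t; rewrite normrN. Qed.

Lemma loB w v : lo w -> lo v -> lo (fun t => w t - v t).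
Proof. by move=> hw hv; apply: loD => //; exact: loN. Qed.

Lemma lo_sum (I : finType) (w : I -> R -> R) :
  (forall i, lo (w i)) -> lo (fun t => \sum_i w i t).
Proof.
move=> hw; elim: (index_enum I) => [|i s IH].
  by apply: lo_eq lo0 _; apply: nearW => t; rewrite big_nil.
by apply: lo_eq (loD (hw i) IH) _; apply: nearW => t; rewrite big_cons.
Qed.

Lemma lo_cvg0 w : lo w -> w @ 0^'+ --> (0 : R).
Proof.
move=> /loP/(_ 1 ltr01) hw; apply/cvgrPdist_le => e e0.
apply: filterS2 hw (nbhs_right_le e0) => t; rewrite mul1r sub0r normrN.
exact: le_trans.
Qed.

Lemma cvg_near_bounded (T : topologicalType) (F : set_system T) (FF : ProperFilter F)
    (h : T -> R) (l : R) :
  h @ F --> l -> \forall t \near F, `|h t| <= `|l| + 1.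
Proof.
move=> /cvgrPdist_le/(_ 1 ltr01); apply: filterS => t ht.
rewrite -[h t](subrK l) addrC; apply: le_trans (ler_normD _ _) _.
by rewrite lerD2l distrC.
Qed.

(** The constant becomes a term of exponent 0, since [powR t 0] is 1 even at t = 0. Arbitrary finite
    index types let sums and products of expansions be indexed by sum and product types. *)
Lemma RoP x : Ro x <-> exists (I : finType) (c a : I -> R),
  (forall i, 0 <= a i) /\ little_o_t (fun t => x t - \sum_i c i * powR t (a i)).
Proof.
split.
  move=> [k [r [c [a [a0 h]]]]].
  exists 'I_k.+1, (fun i => oapp c r (unlift ord0 i)), (fun i => oapp a 0 (unlift ord0 i)).
  split; first by move=> i; case: (unlift ord0 i) => /=.
  have -> // : (fun t => x t - \sum_(i < k.+1) oapp c r (unlift ord0 i) *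
      powR t (oapp a 0 (unlift ord0 i))) =
    (fun t => x t - (r + \sum_(i < k) c i * powR t (a i))).
  apply/funext => t; rewrite big_ord_recl unlift_none /= powRr0 mulr1.
  by congr (_ - (_ + _)); apply: eq_bigr => i _; rewrite liftK.
move=> [I [c [a [a0 h]]]].
exists #|I|, 0, (fun i => c (enum_val i)), (fun i => a (enum_val i)); split=> //.
have -> // : (fun t => x t - (0 + \sum_(i < #|I|) c (enum_val i) * powR t (a (enum_val i)))) =
   (fun t => x t - \sum_i c i * powR t (a i)).
apply/funext => t; rewrite add0r; congr (_ - _).
by rewrite [RHS](reindex _ (onW_bij _ (@enum_val_bij I))).
Qed.

Lemma powR_addr (t a b : R) : 0 <= a -> 0 <= b -> powR t (a + b) = powR t a * powR t b.
Proof.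
move=> a0 b0; have [/eqP|ab] := eqVneq (a + b) 0; last by rewrite powRD// (negPf ab).
by rewrite paddr_eq0// => /andP[/eqP-> /eqP->]; rewrite addr0 powRr0 mulr1.
Qed.

Lemma powR_right_cvg (a : R) : 0 <= a -> (fun t : R => powR t a) @ 0^'+ --> powR 0 a.
Proof.
rewrite le_eqVlt => /predU1P[<-|a0].
  rewrite powRr0; have -> : (fun t : R => powR t 0) = fun=> 1 by apply/funext => t; rewrite powRr0.
  exact: cvg_cst.
by rewrite powR0 ?gt_eqF//; exact: powR_cvg0.
Qed.

Lemma Ro_cvg x : Ro x -> x @ 0^'+ --> x 0.
Proof.
move=> /RoP[I [c [a [a0 [h0 h]]]]].
have -> : x = (fun t => x t - \sum_i c i * powR t (a i)) \+ (fun t => \sum_i c i * powR t (a i)).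
  by apply/funext => t /=; rewrite subrK.
rewrite /= h0; apply: cvgD; first exact: lo_cvg0.
apply: cvg_big; first exact: add_continuous.
move=> i _; apply: cvgM; first exact: cvg_cst.
exact: powR_right_cvg.
Qed.

Lemma Ro_bounded x : Ro x -> exists C, \forall t \near 0^'+, `|x t| <= C.
Proof. by move=> /Ro_cvg/cvg_near_bounded hx; exists (`|x 0| + 1). Qed.

Lemma Ro_add x y : Ro x -> Ro y -> Ro (fun t => x t + y t).
Proof.
move=> /RoP[I [c [a [a0 [hx0 hx]]]]] /RoP[J [d [b [b0 [hy0 hy]]]]]; apply/RoP.
exists (I + J)%type, (fun i => match i with inl i => c i | inr j => d j end),
  (fun i => match i with inl i => a i | inr j => b j end).
split; first by case.
have E t : x t + y t - \sum_(i : I + J) (match i with inl i => c i | inr j => d j end) *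
    powR t (match i with inl i => a i | inr j => b j end) =
  (x t - \sum_i c i * powR t (a i)) + (y t - \sum_j d j * powR t (b j)).
  by rewrite big_sumType/= opprD addrACA.
split; first by rewrite E hx0 hy0 addr0.
by apply: lo_eq (loD hx hy) _; apply: nearW.
Qed.

Lemma Ro_mul x y : Ro x -> Ro y -> Ro (fun t => x t * y t).
Proof.
move=> Rx Ry; have [Cy hCy] := Ro_bounded Ry.
move: Rx Ry => /RoP[I [c [a [a0 [hx0 hx]]]]] Ry.
move: (Ry) => /RoP[J [d [b [b0 [hy0 hy]]]]]; apply/RoP.
exists (I * J)%type, (fun i => c i.1 * d i.2), (fun i => a i.1 + b i.2).
split; first by move=> i; rewrite addr_ge0.
pose X t := \sum_i c i * powR t (a i); pose Y t := \sum_i d i * powR t (b i).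
have RX : Ro X.
  apply/RoP; exists I, c, a; split => //; rewrite /X.
  split; first by rewrite subrr.
  by apply: lo_eq lo0 _; apply: nearW => t; rewrite subrr.
have [CX hCX] := Ro_bounded RX.
(* x y - X Y = (x - X) y + (y - Y) X: each summand is lo times a function bounded near 0. *)
have E t : x t * y t - \sum_(i : I * J) (c i.1 * d i.2) * powR t (a i.1 + b i.2) =
  (x t - X t) * y t + (y t - Y t) * X t.
  have -> : \sum_(i : I * J) (c i.1 * d i.2) * powR t (a i.1 + b i.2) = X t * Y t.
    rewrite /X /Y big_distrlr pair_big /=; apply: eq_bigr => i _.
    by rewrite mulrACA powR_addr.
  by ring.
split; first by rewrite E -/(X 0) hx0 hy0 !mul0r addr0.
by apply: lo_eq (loD (loM hx hCy) (loM hy hCX)) _; apply: nearW.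
Qed.

Lemma Ro_sum (I : finType) (F : I -> R -> R) :
  (forall i, Ro (F i)) -> Ro (fun t => \sum_i F i t).
Proof.
move=> RF; elim: (index_enum I) => [|i s IH].
  by have := Ro_const (0 : R); congr Ro; apply/funext => t; rewrite big_nil.
by have := Ro_add (RF i) IH; congr Ro; apply/funext => t; rewrite big_cons.
Qed.

Lemma lo_val0 x y : Ro x -> Ro y -> lo (fun t => x t - y t) -> x 0 = y 0.
Proof.
move=> /Ro_cvg hx /Ro_cvg hy /lo_cvg0 hxy; apply/eqP; rewrite -subr_eq0; apply/eqP.
exact: (cvg_unique _ (cvgB hx hy) hxy).
Qed.

(** [lo] says nothing about [x 0]; the limit hypothesis is what ties that value to the expansion of
    [y]. *)
Lemma Ro_lo x y : Ro y -> lo (fun t => x t - y t) -> x @ 0^'+ --> x 0 -> Ro x.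
Proof.
move=> Ry hxy hx; have xy0 : x 0 = y 0.
  apply/eqP; rewrite -subr_eq0; apply/eqP.
  exact: (cvg_unique _ (cvgB hx (Ro_cvg Ry)) (lo_cvg0 hxy)).
have /RoP[I [c [a [a0 [hy0 hy]]]]] := Ry; apply/RoP; exists I, c, a; split => //.
split; first by rewrite xy0.
apply: lo_eq (loD hxy hy) _; apply: nearW => t.
by rewrite addrA subrK.
Qed.

(** * Nilpotent elements modulo o(t) *)

Lemma lo_expS w n m : w @ 0^'+ --> (0 : R) -> lo (fun t => w t ^+ n) -> (n <= m)%N ->
  lo (fun t => w t ^+ m).
Proof.
move=> w0 hn nm; have hw : \forall t \near 0^'+, `|w t ^+ (m - n)| <= 1.
  move/cvgrPdist_le : w0 => /(_ 1 ltr01); apply: filterS => t.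
  by rewrite sub0r normrN normrX => ht; rewrite exprn_ile1.
by apply: lo_eq (loM hn hw) _; apply: nearW => t; rewrite -exprD subnKC.
Qed.

(** The limit makes all higher powers lo as well ([lo_expS]), so two nilpotency exponents can be
    merged into one. *)
Definition nilpotent_mod_lo w : Prop := w @ 0^'+ --> (0 : R) /\ exists n, lo (fun t => w t ^+ n).

Lemma nilpotent_lo w : lo w -> nilpotent_mod_lo w.
Proof.
by move=> hw; split; [exact: lo_cvg0|exists 1%N; apply: lo_eq hw _; exact: nearW].
Qed.

Lemma nilpotentD w v :
  nilpotent_mod_lo w -> nilpotent_mod_lo v -> nilpotent_mod_lo (fun t => w t + v t).
Proof.
move=> [w0 [n hn]] [v0 [m hm]]; split.
  by have H := cvgD w0 v0; rewrite addr0 in H; exact: H.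
exists (n + m)%N; have hw := lo_expS w0 hn (leq_addr m n); have hv := lo_expS v0 hm (leq_addl n m).
set N := (n + m)%N in hw hv *.
have hs : lo (fun t => (`|w t ^+ N| + `|v t ^+ N|) * 2 ^+ N).
  apply/loZ/loD; [apply: lo_le hw _|apply: lo_le hv _]; apply: nearW => t; by rewrite normr_id.
apply: lo_le hs _; apply: nearW => t.
rewrite [leRHS]ger0_norm ?mulr_ge0 ?addr_ge0// ?exprn_ge0// normrX -!normrX.
(* The larger of |p| and |q| bounds |p + q| up to a factor 2, which replaces the binomial
   expansion. *)
have H (p q : R) : `|p| <= `|q| -> `|(p + q) ^+ N| <= (`|p ^+ N| + `|q ^+ N|) * 2 ^+ N.
  move=> pq; rewrite !normrX; apply: (@le_trans _ _ ((`|q| * 2) ^+ N)).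
    rewrite lerXn2r ?nnegrE ?mulr_ge0//; apply: le_trans (ler_normD _ _) _; lra.
  by rewrite exprMn ler_wpM2r ?exprn_ge0// lerDr exprn_ge0.
have [/H//|/ltW/H hvw] := leP `|w t| `|v t|.
by rewrite addrC [X in _ <= X * _]addrC.
Qed.

Lemma nilpotentZ w c : nilpotent_mod_lo w -> nilpotent_mod_lo (fun t => w t * c).
Proof.
move=> [w0 [n hn]]; split.
  by have H := cvgM w0 (cvg_cst c); rewrite mul0r in H; exact: H.
by exists n; apply: lo_eq (loZ (c ^+ n) hn) _; apply: nearW => t; rewrite exprMn.
Qed.

Lemma nilpotent_sum (I : finType) (w : I -> R -> R) :
  (forall i, nilpotent_mod_lo (w i)) -> nilpotent_mod_lo (fun t => \sum_i w i t).
Proof.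
move=> hw; elim: (index_enum I) => [|i s IH].
  by have := nilpotent_lo lo0; congr nilpotent_mod_lo; apply/funext => t; rewrite big_nil.
by have := nilpotentD (hw i) IH; congr nilpotent_mod_lo; apply/funext => t; rewrite big_cons.
Qed.

Lemma nilpotent_norm w : nilpotent_mod_lo w -> nilpotent_mod_lo (fun t => `|w t|).
Proof.
move=> [w0 [n hn]]; split.
  by have H := cvg_norm w0; rewrite normr0 in H; exact: H.
by exists n; apply: lo_le hn _; apply: nearW => t; rewrite -normrX normr_id.
Qed.

Lemma nilpotent_powR (a : R) : 0 <= a -> nilpotent_mod_lo (fun t => powR t a - powR 0 a).
Proof.
rewrite le_eqVlt => /predU1P[<-|a0].
  by have := nilpotent_lo lo0; congr nilpotent_mod_lo; apply/funext => t; rewrite !powRr0 subrr.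
rewrite powR0 ?gt_eqF//.
have -> : (fun t : R => powR t a - 0) = fun t => powR t a by apply/funext => t; rewrite subr0.
split; first exact: powR_cvg0.
(* Any n > 2/a gives (t^a)^n <= t^2 <= e t as soon as t <= 1 and t <= e. *)
exists (Num.truncn (2 / a)).+1; apply/loP => e e0.
apply: filterS2 (nbhs_right_gt (0:R)) (filterI (nbhs_right_le e0) (nbhs_right_le ltr01))
  => t t0 [te t1].
rewrite ger0_norm ?exprn_ge0 ?powR_ge0// -powR_mulrn ?powR_ge0// -powRrM.
apply: (@le_trans _ _ (t `^ 2)).
  apply: ger_powR; first by rewrite t0 t1.
  rewrite mulrC -ler_pdivrMr//.
  by apply/ltW/truncnS_gt.
by rewrite (powR_mulrn 2%N (ltW t0)) expr2; apply: ler_wpM2r => //; exact: ltW.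
Qed.

Lemma Ro_nilpotent x : Ro x -> nilpotent_mod_lo (fun t => x t - x 0).
Proof.
move=> /RoP[I [c [a [a0 [h0 h]]]]].
have -> : (fun t => x t - x 0) = (fun t => (x t - \sum_i c i * powR t (a i)) +
    \sum_i (powR t (a i) - powR 0 (a i)) * c i).
  apply/funext => t; have -> : x 0 = \sum_i c i * powR 0 (a i) by apply/eqP; rewrite -subr_eq0 h0.
  under [X in _ = _ + X]eq_bigr do rewrite mulrBl !(mulrC _ (c _)).
  by rewrite sumrB addrA subrK.
apply: nilpotentD; first exact: nilpotent_lo.
by apply: nilpotent_sum => i; apply/nilpotentZ/nilpotent_powR.
Qed.

(** * Representatives of Fermat reals *)

Lemma repr_Ro x (z : FR R) : repr_of x z -> Ro x.
Proof. by case: z => C [y [hy eC]]; rewrite /repr_of /= eC => -[]. Qed.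

Lemma repr_lo x y (z : FR R) : repr_of x z -> repr_of y z -> lo (fun t => x t - y t).
Proof.
case: z => C [u [hu eC]]; rewrite /repr_of /= eC => -[Rx [_ hx]] [Ry [_ hy]].
apply: lo_eq (loB hx hy) _; apply: nearW => t; ring.
Qed.

Lemma repr_st x (z : FR R) : repr_of x z -> st z = x 0.
Proof.
move=> xz; have rz : repr_of (rep z) z by rewrite /rep; case: cid.
exact: lo_val0 (repr_Ro rz) (repr_Ro xz) (repr_lo rz xz).
Qed.

Lemma repr_FR_of x (hx : Ro x) : repr_of x (FR_of hx).
Proof.
rewrite /repr_of /=; split => //; split; first by rewrite subrr.
by apply: lo_eq lo0 _; apply: nearW => t; rewrite subrr.
Qed.

Lemma repr_eq x y (z z' : FR R) : repr_of x z -> repr_of y z' ->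
  lo (fun t => x t - y t) -> z = z'.
Proof.
move=> xz yz' xy; have Rx := repr_Ro xz; have Ry := repr_Ro yz'.
have E : proj1_sig z = proj1_sig z'.
  (* Classes are saturated under congruence; the condition at 0 in [fsim] comes from [lo_val0]. *)
  have H u v (s : FR R) : repr_of u s -> Ro v -> lo (fun t => v t - u t) -> repr_of v s.
    case: s => C [w [hw eC]]; rewrite /repr_of /= eC => -[Ru [_ uw]] Rv vu; split=> //.
    have vw : lo (fun t => v t - w t).
      apply: lo_eq (loD vu uw) _; apply: nearW => t; ring.
    by split => //; apply/eqP; rewrite subr_eq0; apply/eqP/lo_val0.
  apply/seteqP; split => u uz.
    apply: H yz' (repr_Ro (z:=z) uz) _; apply: lo_eq (loD (repr_lo (z:=z) uz xz) xy) _.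
    apply: nearW => t; ring.
  apply: H xz (repr_Ro (z:=z') uz) _; apply: lo_eq (loB (repr_lo (z:=z') uz yz') xy) _.
  apply: nearW => t; ring.
case: z z' E {xz yz'} => C hC [C' hC'] /= E.
by subst C'; congr exist; exact: Prop_irrelevance.
Qed.

End LittleO.

(** * Expansion of smooth maps along nilpotent paths *)

Section Expansion.
Context (R : realType).

Lemma mean_value_le (f df : R -> R) (a b C : R) : a <= b ->
  (forall s, a <= s <= b -> is_derive s 1 f (df s)) ->
  (forall s, a <= s <= b -> `|df s| <= C) -> `|f b - f a| <= C * (b - a).
Proof.
move=> ab hf hC.
have [||c cab ->] := @MVT_segment R f df a b ab.
- by move=> s /andP[/ltW sa /ltW sb]; apply: hf; apply/andP.
- apply: derivable_within_continuous => s; rewrite in_itv /= => sab.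
  by have [] := hf _ sab.
rewrite normrM (ger0_norm (_ : 0 <= b - a)) ?subr_ge0//.
by rewrite ler_wpM2r ?subr_ge0//; exact: hC.
Qed.

(** The derivation rules in pointwise [fun] form, ready for explicit expressions. They fix the shape
    [f + (-1) * g] in which differences are written below. *)
Lemma is_derive_addf (f g : R -> R) (s a b : R) :
  is_derive s 1 f a -> is_derive s 1 g b -> is_derive s 1 (fun r => f r + g r) (a + b).
Proof. by move=> hf hg; exact: is_deriveD. Qed.

Lemma is_derive_mulf (k : R) (f : R -> R) (s a : R) :
  is_derive s 1 f a -> is_derive s 1 (fun r => k * f r) (k * a).
Proof. by move=> hf; exact: is_deriveZ. Qed.

Lemma is_derive_sumf (I : finType) (f : I -> R -> R) (s : R) (a : I -> R) :
  (forall i, is_derive s 1 (f i) (a i)) ->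
  is_derive s 1 (fun r => \sum_i f i r) (\sum_i a i).
Proof.
move=> hf; elim: (index_enum I) => [|i l IH].
  rewrite big_nil (_ : (fun _ => _) = fun=> 0); first exact: is_derive_cst.
  by apply/funext => r; rewrite big_nil.
rewrite big_cons (_ : (fun _ => _) = fun r => f i r + \sum_(j <- l) f j r).
  exact: is_derive_addf.
by apply/funext => r; rewrite big_cons.
Qed.

Lemma is_derive_expf (k : nat) (s : R) :
  is_derive s 1 (fun r : R => r ^+ k.+1) (k.+1%:R * s ^+ k).
Proof.
have -> : (fun r : R => r ^+ k.+1) = (id : R -> R) ^+ k.+1.
  apply/funext => r; elim: k => // k IH.
  by rewrite exprS IH [RHS](_ : _ = r * ((id : R -> R) ^+ k.+1) r) // exprS.
have H := is_deriveX k.+1 (is_derive_id (s : R) (1 : R)).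
by apply: is_derive_eq H _; rewrite /GRing.scale /= mulr1.
Qed.

Context (V : normedModType R).
Implicit Types (U : set V) (g : V -> R) (u w : V).

Lemma smooth_on_derive U g w : smooth_on U g -> smooth_on U (fun x => 'D_w g x).
Proof. by move=> h k; have [_ /(_ w)] := h k.+1. Qed.

Lemma smooth_on_differentiable U g u : smooth_on U g -> U u -> differentiable g u.
Proof. by move=> h Uu; have [/(_ u Uu)] := h 1%N. Qed.

Lemma smooth_on_continuous U g u : smooth_on U g -> U u -> {for u, continuous g}.
Proof. by move=> hg Uu; exact/differentiable_continuous/(smooth_on_differentiable hg). Qed.

Lemma is_derive_line g u w (s : R) : differentiable g (u + s *: w) ->
  is_derive s 1 (fun r => g (u + r *: w)) ('D_w g (u + s *: w)).
Proof.
move=> dg; have dw : derivable g (u + s *: w) w by exact: diff_derivable.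
have E : (fun h : R => h^-1 *: (((fun r => g (u + r *: w)) \o shift s) (h *: 1) -
      g (u + s *: w))) =
   (fun h => h^-1 *: ((g \o shift (u + s *: w)) (h *: w) - g (u + s *: w))).
  apply/funext => h /=; congr (_ *: (g _ - _)).
  by rewrite [X in (X + s) *: w](mulr1 h : h *: 1 = h) scalerDl addrCA.
by apply: DeriveDef; rewrite /derivable /derive E.
Qed.

(** * Approximants with separated variables *)

Section Separated.
Variable U : set V.

(** [s] is the position on the segment from u to u + h t. Polynomial dependence on [s] makes the
    class stable under integration in [s] and multiplication by elements of [Ro], the operations
    that build Taylor approximants here. *)
Inductive separated : (R -> R -> V -> R) -> Prop :=
| separated0 : separated (fun _ _ _ => 0)
| separated_cons T k G q : Ro T -> smooth_on U G -> separated q ->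
    separated (fun t s u => T t * s ^+ k * G u + q t s u).

Lemma separatedD q r : separated q -> separated r ->
  separated (fun t s u => q t s u + r t s u).
Proof.
move=> hq hr; elim: hq => [|T k G {}q RT sG _ IH].
  by move: hr; congr separated; do 3 apply/funext => ?; rewrite add0r.
have := separated_cons k RT sG IH; congr separated.
by do 3 apply/funext => ?; rewrite addrA.
Qed.

Lemma separated_sum (I : finType) (q : I -> R -> R -> V -> R) :
  (forall i, separated (q i)) -> separated (fun t s u => \sum_i q i t s u).
Proof.
move=> hq; elim: (index_enum I) => [|i l IH].
  by have := separated0; congr separated; do 3 apply/funext => ?; rewrite big_nil.
have := separatedD (hq i) IH; congr separated.
by do 3 apply/funext => ?; rewrite big_cons.
Qed.

Lemma separatedM T q : Ro T -> separated q -> separated (fun t s u => T t * q t s u).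
Proof.
move=> RT; elim=> [|S k G {}q RS sG _ IH].
  by have := separated0; congr separated; do 3 apply/funext => ?; rewrite mulr0.
have := separated_cons k (Ro_mul RT RS) sG IH; congr separated.
by do 3 apply/funext => ?; rewrite mulrDr !mulrA.
Qed.

(** s^k integrates to s^(k+1)/(k+1), with 1/(k+1) absorbed into [T]. Normalising at s = 0 lets the
    approximant of g start exactly at g u. *)
Lemma separated_antiderivative q : separated q -> exists Q, [/\ separated Q,
  forall t u, Q t 0 u = 0 &
  forall (t s : R) u, is_derive s 1 (fun r : R => Q t r u) (q t s u)].
Proof.
elim=> [|T k G {}q RT sG _ [Q [sQ Q0 dQ]]].
  by exists (fun _ _ _ => 0); split => //; [exact: separated0|move=> *; exact: is_derive_cst].
exists (fun t s u => T t * k.+1%:R^-1 * s ^+ k.+1 * G u + Q t s u); split.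
- exact: separated_cons (Ro_mul RT (Ro_const _)) sG sQ.
- by move=> t u; rewrite Q0 expr0n mulr0 mul0r addr0.
move=> t s u; have dQ' := dQ t s u.
have k0 : (k.+1%:R : R) != 0 by rewrite pnatr_eq0.
have := is_derive_addf (is_derive_mulf (T t * k.+1%:R^-1 * G u) (is_derive_expf k s)) (dQ t s u).
rewrite (_ : _ * _ * G u * _ = T t * s ^+ k * G u); last by field.
by congr is_derive; apply/funext => r; rewrite mulrAC.
Qed.

Lemma separated_split q : separated q -> exists N (T : 'I_N -> R -> R) (G : 'I_N -> V -> R),
  [/\ forall i, Ro (T i), forall i, smooth_on U (G i) &
      forall t u, q t 1 u = \sum_i T i t * G i u].
Proof.
elim=> [|T k G {}q RT sG _ [N [S [H [RS sH E]]]]].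
  by exists 0%N, (fun _ _ => 0), (fun _ _ => 0); split; [case|case|move=> *; rewrite big_ord0].
exists N.+1, (fun i => oapp S T (unlift ord0 i)), (fun i => oapp H G (unlift ord0 i)); split.
- by move=> i; case: unlift.
- by move=> i; case: unlift.
move=> t u; rewrite big_ord_recl unlift_none /= expr1n mulr1 E; congr (_ + _).
by apply: eq_bigr => i _; rewrite liftK.
Qed.

End Separated.

Variables (U : set V) (J : finType) (c : J -> V) (tau : J -> R -> R).
Hypothesis openU : open U.
Hypothesis Ro_tau : forall j, Ro (tau j).
Hypothesis nilpotent_tau : forall j, nilpotent_mod_lo (tau j).

(** [h] is the displacement along fixed directions with nilpotent coefficients; [rho] majorizes all
    these coefficients, and its powers measure the order of the remainder. *)
Let h t := \sum_j tau j t *: c j.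
Let rho (t : R) : R := \sum_j `|tau j t|.

Lemma h_cvg0 : h @ 0^'+ --> (0 : V).
Proof.
rewrite /h; elim: (index_enum J) => [|j l IH].
  by under eq_fun do rewrite big_nil; exact: cvg_cst.
under eq_fun do rewrite big_cons.
have [hj _] := nilpotent_tau j; have := cvgD (cvgZ hj (cvg_cst (c j))) IH.
by rewrite scale0r => H; rewrite addr0 in H; exact: H.
Qed.

Lemma near_segment (u0 : V) (A : set V) : nbhs u0 A ->
  \forall t \near 0^'+ & u \near nbhs u0, forall s, 0 <= s <= 1 -> A (u + s *: h t).
Proof.
move=> /nbhs_normP[e /= e0 hA].
have e2 : 0 < e / 2 by rewrite divr_gt0.
near=> t u => s /andP[s0 s1]; apply: hA => /=.
rewrite opprD addrA (splitr e); apply: le_lt_trans (ler_normB _ _) _.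
apply: ltr_leD.
  by near: u; apply/nbhs_normP; exists (e / 2).
rewrite normrZ ger0_norm//; apply: le_trans (_ : `|h t| <= _).
  by rewrite ler_piMl.
near: t; move/cvgrPdist_le : h_cvg0 => /(_ _ e2); apply: filterS => t /=.
by rewrite sub0r normrN.
Unshelve. all: by end_near. Qed.

Lemma rho_ge0 t : 0 <= rho t.
Proof. by apply: sumr_ge0 => j _; exact: normr_ge0. Qed.

Lemma nilpotent_rho : nilpotent_mod_lo rho.
Proof. by apply: nilpotent_sum => j; exact: nilpotent_norm. Qed.

(* Induction on [n]: the approximants of the directional derivatives of [g] are
   integrated in [s], and each integration gains one factor [rho t]. *)
Lemma expansion n g u0 : smooth_on U g -> U u0 ->
  exists q C, separated U q /\
    \forall t \near 0^'+ & u \near nbhs u0, forall s, 0 <= s <= 1 ->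
      `|g (u + s *: h t) - q t s u| <= C * rho t ^+ n.
Proof.
elim: n g => [|n IH] g sg Uu0.
  exists (fun _ _ _ => 0), (`|g u0| + 1); split; first exact: separated0.
  have nb : \forall t \near 0^'+ & u \near nbhs u0, forall s, 0 <= s <= 1 ->
      `|g (u + s *: h t)| <= `|g u0| + 1.
    exact: near_segment (cvg_near_bounded _ (smooth_on_continuous sg Uu0)).
  apply: filterS nb => -[t u] /= H s s01.
  by rewrite subr0 expr0 mulr1; exact: H.
have /choice[qC hqC] : forall j, exists qC : (R -> R -> V -> R) * R, separated U qC.1 /\
    \forall t \near 0^'+ & u \near nbhs u0, forall s, 0 <= s <= 1 ->
      `|'D_(c j) g (u + s *: h t) - qC.1 t s u| <= qC.2 * rho t ^+ n.
  move=> j; have [q [C H]] := IH _ (smooth_on_derive (c j) sg) Uu0.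
  by exists (q, C).
have /choice[Q hQ] := fun j => separated_antiderivative (hqC j).1.
pose K := \sum_j `|(qC j).2|.
exists (fun t s u => 1 * s ^+ 0 * g u + \sum_j tau j t * Q j t s u), K; split.
  apply: (@separated_cons U (fun=> 1) 0 g (fun t s u => \sum_j tau j t * Q j t s u)) => //.
    exact: Ro_const.
  by apply: separated_sum => j; apply: separatedM => //; case: (hQ j).
have nU : \forall t \near 0^'+ & u \near nbhs u0, forall s, 0 <= s <= 1 -> U (u + s *: h t).
  exact/near_segment/open_nbhs_nbhs.
have nQ : \forall t \near 0^'+ & u \near nbhs u0, forall j s, 0 <= s <= 1 ->
      `|'D_(c j) g (u + s *: h t) - (qC j).1 t s u| <= (qC j).2 * rho t ^+ n.
  pose P j (x : R * V) := forall s, 0 <= s <= 1 ->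
    `|'D_(c j) g (x.2 + s *: h x.1) - (qC j).1 x.1 s x.2| <= (qC j).2 * rho x.1 ^+ n.
  have hP j : filter_prod 0^'+ (nbhs u0) (P j) by case: (hqC j).
  exact: (@filter_forall (R * V)%type J P (filter_prod 0^'+ (nbhs u0)) _ hP).
apply: filterS2 nU nQ => -[t u] /= nU nQ s s01.
(* Every [Q j] vanishes at r = 0, so f s - f 0 is exactly the error to be bounded, and the mean
   value theorem in r applies. *)
pose f (r : R) := g (u + r *: h t) + (-1) * \sum_j tau j t * Q j t r u.
pose df (r : R) := 'D_(h t) g (u + r *: h t) + (-1) * \sum_j tau j t * (qC j).1 t r u.
have /andP[s0 s1] := s01.
have := @mean_value_le f df 0 s (K * rho t ^+ n.+1) s0.
have -> : f s - f 0 = g (u + s *: h t) - (1 * s ^+ 0 * g u + \sum_j tau j t * Q j t s u).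
  rewrite /f scale0r addr0 [X in _ - (_ + -1 * X)]big1 => [|j _]; last first.
    by have [_ -> _] := hQ j; rewrite mulr0.
  by rewrite mulr0 addr0 mulN1r expr0 !mul1r opprD addrA addrAC.
move=> H; apply: le_trans (H _ _) _.
- move=> r /andP[r0 rs]; apply: is_derive_addf.
    apply/is_derive_line/(smooth_on_differentiable sg)/nU.
    by rewrite r0 (le_trans rs).
  apply/is_derive_mulf/is_derive_sumf => j; apply: is_derive_mulf.
  by have [_ _] := hQ j; apply.
- move=> r /andP[r0 rs]; have r01 : 0 <= r <= 1 by rewrite r0 (le_trans rs).
  (* The differential is linear in [h t], so the derivative of the error is a combination of the
     errors of order n with coefficients [tau j t], each at most [rho t]. *)
  have -> : df r = \sum_j tau j t * ('D_(c j) g (u + r *: h t) - (qC j).1 t r u).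
    have dg := smooth_on_differentiable sg (nU r r01).
    rewrite /df deriveE// [X in 'd g _ X]/h linear_sum mulN1r.
    under [RHS]eq_bigr do rewrite mulrBr.
    rewrite sumrB; congr (_ - _); apply: eq_bigr => j _.
    by rewrite linearZ/= deriveE.
  apply: le_trans (ler_norm_sum _ _ _) _.
  rewrite /K mulr_suml; apply: ler_sum => j _.
  rewrite normrM exprS [leRHS]mulrCA; apply: ler_pM => //.
    by rewrite /rho (bigD1 j)//= lerDl; apply: sumr_ge0.
  apply: le_trans (nQ j r r01) _.
  by rewrite ler_wpM2r ?exprn_ge0 ?rho_ge0// ler_norm.
rewrite subr0 ler_piMr// mulr_ge0 ?exprn_ge0 ?rho_ge0//.
by apply: sumr_ge0.
Qed.

(** Taking for n a nilpotency exponent of [rho] makes the remainder lo, with one [eta] for all u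
    near u0; at s = 1 the powers of s disappear. *)
Lemma lo_expansion g u0 : smooth_on U g -> U u0 ->
  exists N (T : 'I_N -> R -> R) (G : 'I_N -> V -> R) (eta : R -> R),
  [/\ forall i, Ro (T i), forall i, smooth_on U (G i), lo eta &
    \forall t \near 0^'+ & u \near nbhs u0,
      `|g (u + h t) - \sum_i T i t * G i u| <= eta t].
Proof.
move=> sg Uu0; have [_ [n hn]] := nilpotent_rho.
have [q [C [sq Hq]]] := expansion n sg Uu0.
have [N [T [G [RT sG E]]]] := separated_split sq.
exists N, T, G, (fun t => rho t ^+ n * C); split => //; first exact: loZ.
apply: filterS Hq => -[t u] /= /(_ 1); rewrite ler01 lexx scale1r E mulrC.
exact.
Qed.

(** At the fixed base point the expansion is a combination of elements of [Ro] up to lo;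
    [tau j 0 = 0] gives the right-continuity at 0 that [Ro_lo] asks for. *)
Lemma Ro_smooth g u0 : smooth_on U g -> U u0 -> (forall j, tau j 0 = 0) ->
  Ro (fun t => g (u0 + h t)).
Proof.
move=> sg Uu0 tau0; have [N [T [G [eta [RT sG leta H]]]]] := lo_expansion sg Uu0.
apply: (@Ro_lo _ _ (fun t => \sum_i T i t * G i u0)).
- by apply: Ro_sum => i; apply: Ro_mul => //; exact: Ro_const.
- apply: lo_le leta _.
  have [[A B] /= [hA hB] AB] := H.
  apply: filterS hA => t At; apply: le_trans (ler_norm _).
  by apply: (AB (t, u0)); split => //=; exact: nbhs_singleton.
rewrite {2}/h big1 ?addr0 => [|j _]; last by rewrite tau0 scale0r.
apply: (@cvg_comp _ _ _ (fun t => u0 + h t) g _ (nbhs u0)); last exact: smooth_on_continuous sg Uu0.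
by have H' := cvgD (cvg_cst u0) h_cvg0; rewrite addr0 in H'; exact: H'.
Qed.

(** A first-order mean value estimate: near u0 the derivatives along the [c j] are bounded, and
    [rho] is lo. The base point may move with t. *)
Lemma smooth_lo g u0 (v : R -> V) : smooth_on U g -> U u0 -> (forall j, lo (tau j)) ->
  v @ 0^'+ --> u0 -> lo (fun t => g (v t + h t) - g (v t)).
Proof.
move=> sg Uu0 lotau hv.
pose K := \sum_j (`|'D_(c j) g u0| + 1).
have K0 : 0 <= K by apply: sumr_ge0 => j _; rewrite addr_ge0.
have nU : \forall t \near 0^'+ & u \near nbhs u0, forall s, 0 <= s <= 1 -> U (u + s *: h t).
  exact/near_segment/open_nbhs_nbhs.
pose P j (x : R * V) := forall s, 0 <= s <= 1 ->
  `|'D_(c j) g (x.2 + s *: h x.1)| <= `|'D_(c j) g u0| + 1.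
have nP : filter_prod 0^'+ (nbhs u0) (fun x => forall j, P j x).
  apply: (@filter_forall (R * V)%type J P (filter_prod 0^'+ (nbhs u0)) _) => j.
  exact: near_segment (cvg_near_bounded _ (smooth_on_continuous (smooth_on_derive (c j) sg) Uu0)).
have lorho : lo (fun t => rho t * K).
  apply: loZ; apply: (@lo_sum R J (fun j t => `|tau j t|)) => j.
  by apply: lo_le (lotau j) _; apply: nearW => t; rewrite normr_id.
have hvt : (fun t => (t, v t)) @ 0^'+ --> filter_prod 0^'+ (nbhs u0).
  move=> A [[B C] /= [hB hC] BC]; apply: filterS2 hB (hv _ hC) => t Bt Ct.
  exact: (BC (t, v t)).
apply: lo_le lorho _.
apply: (@filterS R 0^'+ _ _ _ _ (hvt _ (filterI nU nP))) => t /= [Ut Pt].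
rewrite [leRHS]ger0_norm ?mulr_ge0 ?rho_ge0//.
have := @mean_value_le (fun r => g (v t + r *: h t)) (fun r => 'D_(h t) g (v t + r *: h t))
  0 1 (rho t * K) ler01.
rewrite scale1r scale0r addr0 subr0 mulr1; apply => s s01.
  exact/is_derive_line/(smooth_on_differentiable sg)/Ut.
rewrite deriveE; last exact/(smooth_on_differentiable sg)/Ut.
rewrite [X in 'd g _ X]/h linear_sum; apply: le_trans (ler_norm_sum _ _ _) _.
rewrite /K mulr_sumr; apply: ler_sum => j _.
rewrite linearZ/= -deriveE; last exact/(smooth_on_differentiable sg)/Ut.
rewrite normrM; apply: ler_pM => //; last exact: Pt.
by rewrite /rho (bigD1 j)//= lerDl; apply: sumr_ge0.
Qed.

End Expansion.

(** * Independence modulo o(t) *)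

Section Independence.
Context (R : realType).

Definition independent_mod_lo N (T : 'I_N -> R -> R) : Prop :=
  forall c : 'I_N -> R, lo (fun t => \sum_i c i * T i t) -> forall i, c i = 0.

(** Induction on N: the head either is a combination of the functions already kept, modulo lo, or is
    adjoined to them. The kept functions come from the family, so they inherit [P]. *)
Lemma reduce_independent_ord (P : (R -> R) -> Prop) N (T : 'I_N -> R -> R) :
  (forall i, P (T i)) ->
  exists M (S : 'I_M -> R -> R) (l : 'I_N -> 'I_M -> R),
    [/\ forall j, P (S j), independent_mod_lo S &
        forall i, lo (fun t => T i t - \sum_j l i j * S j t)].
Proof.
elim: N T => [|N IH] T PT.
  by exists 0%N, (fun _ _ => 0), (fun _ _ => 0); split => [[]|c _ []|[]].
have [M [S [l [PS indS hl]]]] := IH (fun i => T (lift ord0 i)) (fun i => PT _).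
have [[m hm]|nm] := pselect (exists m : 'I_M -> R, lo (fun t => T ord0 t - \sum_j m j * S j t)).
  exists M, S, (fun i => oapp l m (unlift ord0 i)); split => // i.
  by case: (unliftP ord0 i) => [k|] -> //=; exact: hl.
exists M.+1, (fun j => oapp S (T ord0) (unlift ord0 j)),
  (fun i j => match unlift ord0 i, unlift ord0 j with
    | Some i', Some j' => l i' j' | None, None => 1 | _, _ => 0 end); split.
- by move=> j; case: (unlift ord0 j) => [k|] /=; [exact: PS|exact: PT].
- move=> c hc; have E t : \sum_(i < M.+1) c i * oapp S (T ord0) (unlift ord0 i) t =
      c ord0 * T ord0 t + \sum_(i < M) c (lift ord0 i) * S i t.
    by rewrite big_ord_recl unlift_none; congr (_ + _); apply: eq_bigr => i _; rewrite liftK.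
  have c0 : c ord0 = 0.
    apply: contrapT => /eqP c0; apply: nm; exists (fun j => - c (lift ord0 j) / c ord0).
    apply: lo_eq (loZ (c ord0)^-1 hc) _; apply: nearW => t; rewrite E mulrDl.
    rewrite mulrAC divff// mul1r -sumrN; congr (_ + _); rewrite mulr_suml.
    by apply: eq_bigr => i _; rewrite mulNr mulNr opprK mulrAC.
  move=> i; case: (unliftP ord0 i) => [k ->|-> //].
  apply: (indS (fun k => c (lift ord0 k))).
  by apply: lo_eq hc _; apply: nearW => t; rewrite E c0 mul0r add0r.
move=> i; case: (unliftP ord0 i) => [k|] ->.
  apply: lo_eq (hl k) _; apply: nearW => t.
  rewrite big_ord_recl unlift_none mul0r add0r; congr (_ - _).
  by apply: eq_bigr => j _; rewrite liftK.
apply: lo_eq (@lo0 R) _; apply: nearW => t.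
rewrite big_ord_recl unlift_none mul1r big1 ?addr0 ?subrr// => j _.
by rewrite liftK mul0r.
Qed.

Lemma reduce_independent (I : finType) (P : (R -> R) -> Prop) (T : I -> R -> R) :
  (forall i, P (T i)) ->
  exists M (S : 'I_M -> R -> R) (l : I -> 'I_M -> R),
    [/\ forall j, P (S j), independent_mod_lo S &
        forall i, lo (fun t => T i t - \sum_j l i j * S j t)].
Proof.
move=> PT; have [M [S [l [PS indS hl]]]] :=
  reduce_independent_ord (P := P) (T := fun i : 'I_#|I| => T (enum_val i))
    (fun i => PT (enum_val i)).
exists M, S, (fun i => l (enum_rank i)); split => // i.
by have := hl (enum_rank i); rewrite enum_rankK.
Qed.

(** Rewritten in an independent family, the hypothesis says that finitely many coordinate functions
    of z vanish exactly near r; hence so do their derivatives at r. *)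
Lemma lo_derive (I : finType) (S W : I -> R -> R) (w : I -> R) (r : R) :
  (forall i, is_derive r 1 (W i) (w i)) ->
  (\forall z \near r, lo (fun t => \sum_i S i t * W i z)) ->
  lo (fun t => \sum_i S i t * w i).
Proof.
move=> dW hW; have [M [S' [l [_ ind hl]]]] :=
  reduce_independent (P := fun=> True) (T := S) (fun=> Logic.I).
have E (x : I -> R) t : \sum_i S i t * x i =
    \sum_i (S i t - \sum_j l i j * S' j t) * x i + \sum_j (\sum_i l i j * x i) * S' j t.
  have EB : \sum_i (\sum_j l i j * S' j t) * x i = \sum_j (\sum_i l i j * x i) * S' j t.
    under eq_bigr do rewrite mulr_suml.
    rewrite exchange_big/=; apply: eq_bigr => j _; rewrite mulr_suml.
    by apply: eq_bigr => i _; rewrite mulrAC.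
  under [X in _ = X + _]eq_bigr do rewrite mulrBl.
  by rewrite sumrB EB subrK.
have loE (x : I -> R) : lo (fun t => \sum_i (S i t - \sum_j l i j * S' j t) * x i).
  by apply: lo_sum => i; exact: loZ.
have l0 (x : I -> R) : lo (fun t => \sum_i S i t * x i) -> forall j, \sum_i l i j * x i = 0.
  move=> hx; apply: ind; apply: lo_eq (loB hx (loE x)) _; apply: nearW => t.
  by rewrite E addrAC subrr add0r.
apply: lo_eq (loE w) _; apply: nearW => t; rewrite E [X in _ + X]big1 ?addr0 // => j _.
suff -> : \sum_i l i j * w i = 0 by rewrite mul0r.
have d1 : is_derive r 1 (fun z => \sum_i l i j * W i z) (\sum_i l i j * w i).
  by apply: is_derive_sumf => i; exact: is_derive_mulf.
have d0 : is_derive r 1 (fun _ : R => 0 : R) (\sum_i l i j * w i).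
  apply: near_eq_is_derive d1.
  by apply: filterS hW => z hz; rewrite l0.
have := @derive_val _ _ _ _ _ _ _ d0; rewrite derive_cst; exact: esym.
Qed.

Lemma antiderivative (w : R -> R) (a b : R) : a < b ->
  (forall z, a <= z <= b -> {for z, continuous w}) ->
  exists W : R -> R, forall z, a < z < b -> is_derive z 1 W (w z).
Proof.
move=> ab cw; exists (fun z => \int[lebesgue_measure]_(t in [set` `[a, z]]) w t)%R => z /andP[az zb].
have [] := @continuous_FTC1_closed R w a z b zb _ az _.
- apply: continuous_compact_integrable; first exact: segment_compact.
  apply: continuous_in_subspaceT => x; rewrite inE /= in_itv /=; exact: cw.
- by apply: cw; rewrite !ltW.
by move=> d <-; rewrite derive1E; exact/derivableP.
Qed.

End Independence.

(** * Flatness and local expansions *)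

Section LocalExpansion.
Context (R : realType).

Lemma open_setX (S T : topologicalType) (A : set S) (B : set T) :
  open A -> open B -> open (A `*` B).
Proof.
move=> oA oB; rewrite openE => -[a b] [/= Aa Bb]; exists (A, B) => //=.
by split; apply: open_nbhs_nbhs; split.
Qed.

Lemma continuous_closure_eq0 (w : R -> R) (A : set R) (y : R) : {for y, continuous w} ->
  closure A y -> (\forall z \near y, A z -> w z = 0) -> w y = 0.
Proof.
move=> cw clA w0; apply: contrapT => /eqP wy.
have wy0 : 0 < `|w y| by rewrite normr_gt0.
move/cvgrPdist_lt : cw => /(_ _ wy0) hw.
have [z [Az [w0z]]] := clA _ (filterI w0 hw).
by rewrite /= w0z// subr0 ltxx.
Qed.

Lemma mean_value_dist (f df : R -> R) (x y C : R) :
  (forall s, `|s - y| <= `|x - y| -> is_derive s 1 f (df s)) ->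
  (forall s, `|s - y| <= `|x - y| -> `|df s| <= C) -> `|f x - f y| <= C * `|x - y|.
Proof.
move=> hf hC; have [yx|/ltW xy] := leP y x.
  rewrite (ger0_norm (_ : 0 <= x - y)) ?subr_ge0//.
  by apply: (@mean_value_le R f df) => // s /andP[ys sx]; [apply: hf|apply: hC];
    rewrite !ger0_norm ?subr_ge0// lerD2r.
rewrite distrC (distrC x) (ger0_norm (_ : 0 <= y - x)) ?subr_ge0//.
by apply: (@mean_value_le R f df) => // s /andP[ys sx]; [apply: hf|apply: hC];
  rewrite distrC (distrC x) !ger0_norm ?subr_ge0// lerB.
Qed.

(** All [W k] vanish on the open set [A] near y, hence at y by continuity; n mean value steps from y
    then give order n, also at points z outside [A]. *)
Lemma flat_bound (W : nat -> R -> R) (A : set R) (y : R) n : open A -> closure A y ->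
  (forall k, \forall z \near y, is_derive (z : R) 1 (W k) (W k.+1 z)) ->
  (\forall z \near y, A z -> W 0 z = 0) ->
  exists C, \forall z \near y, `|W 0 z| <= C * `|z - y| ^+ n.
Proof.
move=> oA clA dW W0.
have cW k : {for y, continuous (W k)}.
  have dk := nbhs_singleton (dW k).
  by apply/differentiable_continuous/derivable1_diffP; case: dk.
have Wk0 k : \forall z \near y, A z -> W k z = 0.
  elim: k => // k IH.
  apply: filterS (near_join (filterI (dW k) IH)) => z hz Az.
  have [dz _] := nbhs_singleton hz.
  have d0 : is_derive z 1 (fun _ : R => 0 : R) (W k.+1 z).
    apply: near_eq_is_derive dz.
    have nA : nbhs z A by apply: open_nbhs_nbhs; split.
    by apply: filterS2 nA hz => x Ax [_]; exact.
  have := @derive_val _ _ _ _ _ _ _ d0; rewrite derive_cst; exact: esym.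
(* All k at once: order n + 1 for [W k] comes from order n for [W k.+1]. *)
suff H : forall k, exists C, \forall z \near y, `|W k z| <= C * `|z - y| ^+ n by exact: H.
elim: n => [|n IH] k.
  exists (`|W k y| + 1).
  by apply: filterS (cvg_near_bounded _ (cW k)) => z; rewrite expr0 mulr1.
have [C hC] := IH k.+1; exists C.
have Wy : W k y = 0 by apply: continuous_closure_eq0 (cW k) clA (Wk0 k).
have nb : nbhs y (fun z : R => is_derive z 1 (W k) (W k.+1 z) /\
    `|W k.+1 z| <= C * `|z - y| ^+ n).
  exact: filterI (dW k) hC.
move: nb => /nbhs_normP[e /= e0 he].
apply/nbhs_normP; exists e => //= z; rewrite /= distrC => zye.
have hs s : `|s - y| <= `|z - y| -> is_derive s 1 (W k) (W k.+1 s) /\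
    `|W k.+1 s| <= C * `|s - y| ^+ n.
  by move=> sz; apply: he; rewrite /= distrC; exact: le_lt_trans zye.
have C0 : 0 <= C * `|z - y| ^+ n.
  by have [_] := hs z (lexx _); exact: le_trans.
have := @mean_value_dist (W k) (W k.+1) z y (C * `|z - y| ^+ n).
rewrite Wy subr0 exprSr mulrA; apply => s sz; have [// _ h] := hs s sz.
apply: le_trans h _.
(* For z = y also s = y; otherwise |z - y|^n > 0 forces [C] to be nonnegative, so monotonicity of
   powers applies. *)
have [zy|zy] := eqVneq z y.
  by move: sz; rewrite zy subrr normr0 normr_le0 subr_eq0 => /eqP ->; rewrite subrr normr0.
rewrite ler_wpM2l ?lerXn2r ?nnegrE//.
by move: C0; rewrite pmulr_lge0// exprn_gt0// normr_gt0 subr_eq0.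
Qed.

(** * Smooth functions of a parameter and one real variable *)

Context (p : nat).
Implicit Types (P : set 'rV[R]_p) (V : set R) (g : 'rV[R]_p * R -> R) (x : 'I_p -> R -> R).

(** [inr] is the direction used by [partial2]. With these directions a displacement of both
    arguments has the form required in the expansion results. *)
Definition basis_dir (j : 'I_p + unit) : 'rV[R]_p * R :=
  match j with inl i => (delta_mx 0 i, 0) | inr _ => (0, 1) end.

Lemma row_pair_expand (x x' : 'I_p -> R) (y y' : R) :
  (\row_i x i, y) = (\row_i x' i, y') +
    \sum_j (match j with inl i => x i - x' i | inr _ => y - y' end) *: basis_dir j.
Proof.
rewrite big_sumType /= big_const card_unit /= addr0.
have -> : \sum_i (x i - x' i) *: (delta_mx 0 i : 'rV[R]_p, 0 : R) =
    (\row_i (x i - x' i), 0).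
  rewrite [\row_i _]row_sum_delta; elim/big_rec2 : _ => // i u v _ ->.
  by rewrite mxE; congr pair; rewrite /= scaler0 addr0.
congr pair => /=; last by rewrite add0r /GRing.scale/= mulr1 addrC subrK.
rewrite scaler0 addr0; apply/rowP => i; rewrite !mxE; ring.
Qed.

Lemma Ro_sub0 (x : R -> R) (r : R) : Ro x -> Ro (fun t => x t - r).
Proof. by move=> Rx; apply: Ro_add => //; exact: Ro_const. Qed.

(** Each argument splits into its value at 0 and a nilpotent part vanishing at 0, which reduces the
    claim to [Ro_smooth]. *)
Lemma Ro_smooth_eval P V g x (y : R -> R) : open P -> open V -> smooth_on (P `*` V) g ->
  (forall i, Ro (x i)) -> Ro y -> P (\row_i x i 0) -> V (y 0) ->
  Ro (fun t => g (\row_i x i t, y t)).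
Proof.
move=> oP oV sg Rx Ry Px Vy.
pose tau (j : 'I_p + unit) t := match j with inl i => x i t - x i 0 | inr _ => y t - y 0 end.
have Rtau j : Ro (tau j) by case: j => *; exact: Ro_sub0.
have ntau j : nilpotent_mod_lo (tau j) by case: j => *; exact: Ro_nilpotent.
have tau0 j : tau j 0 = 0 by case: j => * /=; rewrite subrr.
have oU : open (P `*` V) by exact: open_setX.
have := Ro_smooth basis_dir oU Rtau ntau sg (u0 := (\row_i x i 0, y 0)) (conj Px Vy) tau0.
by congr Ro; apply/funext => t; rewrite [in RHS](row_pair_expand _ (x^~ 0) _ (y 0)).
Qed.

Lemma row_pair_cvg x (y : R -> R) : (forall i, Ro (x i)) -> Ro y ->
  (fun t => (\row_i x i t, y t)) @ 0^'+ --> (\row_i x i 0, y 0).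
Proof.
move=> Rx Ry.
pose tau (j : 'I_p + unit) t := match j with inl i => x i t - x i 0 | inr _ => y t - y 0 end.
have ntau j : nilpotent_mod_lo (tau j) by case: j => *; exact: Ro_nilpotent.
have := cvgD (cvg_cst (\row_i x i 0, y 0)) (h_cvg0 basis_dir ntau).
move=> H; rewrite addr0 in H.
rewrite (_ : (fun t => _) = (fun t => (\row_i x i 0, y 0) + \sum_j tau j t *: basis_dir j)).
  exact: H.
by apply/funext => t; rewrite [in LHS](row_pair_expand _ (x^~ 0) _ (y 0)).
Qed.

(** Well-definedness of the extension of g to Fermat reals: the primed path is the moving base
    point, and the difference of representatives is a displacement that is lo. *)
Lemma lo_smooth_eval P V g x x' (y y' : R -> R) : open P -> open V -> smooth_on (P `*` V) g ->
  (forall i, Ro (x i)) -> (forall i, Ro (x' i)) -> Ro y -> Ro y' ->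
  (forall i, lo (fun t => x i t - x' i t)) -> lo (fun t => y t - y' t) ->
  P (\row_i x i 0) -> V (y 0) ->
  lo (fun t => g (\row_i x i t, y t) - g (\row_i x' i t, y' t)).
Proof.
move=> oP oV sg Rx Rx' Ry Ry' xx' yy' Px Vy.
pose tau (j : 'I_p + unit) t := match j with inl i => x i t - x' i t | inr _ => y t - y' t end.
have ltau j : lo (tau j) by case: j.
have ntau j : nilpotent_mod_lo (tau j) by exact: nilpotent_lo.
have oU : open (P `*` V) by exact: open_setX.
have E : (\row_i x' i 0, y' 0) = (\row_i x i 0, y 0).
  rewrite (lo_val0 Ry Ry' yy'); congr pair; apply/rowP => i.
  by rewrite !mxE (lo_val0 (Rx i) (Rx' i)).
have Uu : (P `*` V) (\row_i x' i 0, y' 0) by rewrite E.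
have := smooth_lo basis_dir oU ntau sg Uu ltau (row_pair_cvg Rx' Ry').
by congr lo; apply/funext => t; rewrite [in RHS](row_pair_expand _ (x'^~ t) _ (y' t)).
Qed.

Lemma smooth_on_iter (U : set ('rV[R]_p * R)%type) g k : smooth_on U g ->
  smooth_on U (iter k (@partial2 R p) g).
Proof. by move=> sg; elim: k => // k IH; exact: (smooth_on_derive (0 : 'rV[R]_p, 1 : R) IH). Qed.

Lemma is_derive_snd P V g (q : 'rV[R]_p) (z : R) : smooth_on (P `*` V) g -> P q -> V z ->
  is_derive z 1 (fun s : R => g (q, s)) (partial2 g (q, z)).
Proof.
move=> sg Pq Vz; have E (s : R) : (q, s) = (q, 0) + s *: (0, 1).
  by congr pair => /=; rewrite ?scaler0 ?addr0// add0r /GRing.scale/= mulr1.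
rewrite (_ : (fun s => _) = (fun s => g ((q, 0) + s *: (0, 1)))); last first.
  by apply/funext => s; rewrite -E.
by rewrite E; apply: is_derive_line; rewrite -E; exact: smooth_on_differentiable sg _.
Qed.

(** Only the parameter is displaced; z stays real. The coefficients are combinations of smooth
    functions frozen at (x0, z), so iterating [partial2] yields the tower of derivatives that
    [flat_bound] consumes. *)
Lemma local_expansion P V g x (z0 : R) : open P -> open V -> smooth_on (P `*` V) g ->
  (forall i, Ro (x i)) -> P (\row_i x i 0) -> V z0 ->
  exists N (T : 'I_N -> R -> R) (W : 'I_N -> nat -> R -> R) (eta : R -> R),
  [/\ forall i, Ro (T i), independent_mod_lo T, lo eta,
    forall i k z, V z -> is_derive z 1 (W i k) (W i k.+1 z) &
    \forall t \near 0^'+ & z \near z0,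
      `|g (\row_i x i t, z) - \sum_i T i t * W i 0 z| <= eta t].
Proof.
move=> oP oV sg Rx Px Vz.
pose tau j t := x j t - x j 0.
pose c (j : 'I_p) : 'rV[R]_p * R := (delta_mx 0 j, 0).
have Rtau j : Ro (tau j) by exact: Ro_sub0.
have ntau j : nilpotent_mod_lo (tau j) by exact: Ro_nilpotent.
have oU : open (P `*` V) by exact: open_setX.
pose x0 := \row_i x i 0.
have Ux0 : (P `*` V) (x0, z0) by split.
have [N [T [G [eta [RT sG leta hT]]]]] :=
  lo_expansion c oU Rtau ntau sg Ux0.
have [M [S [l [RS indS hl]]]] := reduce_independent RT.
pose W j k z := \sum_i l i j * iter k (@partial2 R p) (G i) (x0, z).
(* Error of replacing [T i] by its combination of the independent [S j]; a bound of [G i] near (x0,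
   z0) keeps it uniform in z. *)
pose d i t := `|T i t - \sum_j l i j * S j t| * (`|G i (x0, z0)| + 1).
exists M, S, W, (fun t => eta t + \sum_i d i t); split => //.
- apply: loD => //; apply: lo_sum => i; apply: loZ.
  by apply: lo_le (hl i) _; apply: nearW => t; rewrite normr_id.
- move=> j k z Vz'; apply: is_derive_sumf => i; apply: is_derive_mulf.
  exact: is_derive_snd (smooth_on_iter k (sG i)) Px Vz'.
have cz : (fun z : R => (x0, z)) @ z0 --> (x0, z0).
  move=> A [[B C] /= [hB hC] BC]; apply: (@filterS _ (nbhs z0) _ C) hC => z Cz.
  by apply: (BC (x0, z)); split => //=; exact: nbhs_singleton hB.
have hT' : \forall t \near 0^'+ & z \near z0,
    `|g ((x0, z) + \sum_j tau j t *: c j) - \sum_i T i t * G i (x0, z)| <= eta t.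
  case: hT => -[A B] /= [hA hB] AB; exists (A, (fun z => (x0, z)) @^-1` B) => /=.
    by split => //; exact: cz.
  by move=> [t z] /= [At Bz]; exact: (AB (t, (x0, z))).
have hG : \forall z \near z0, forall i, `|G i (x0, z)| <= `|G i (x0, z0)| + 1.
  apply: (@filter_forall R 'I_N (fun i z => `|G i (x0, z)| <= `|G i (x0, z0)| + 1) (nbhs z0) _) => i.
  have hb : nbhs (x0, z0) (fun u => `|G i u| <= `|G i (x0, z0)| + 1).
    exact: (@cvg_near_bounded R _ (nbhs (x0, z0)) _ (G i) (G i (x0, z0))
      (smooth_on_continuous (sG i) Ux0)).
  exact: (cz _ hb).
have hG' : filter_prod (0^'+ : set_system R) (nbhs z0)
    (fun tz => forall i, `|G i (x0, tz.2)| <= `|G i (x0, z0)| + 1).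
  exists (setT, [set z | forall i, `|G i (x0, z)| <= `|G i (x0, z0)| + 1]) => /=.
    by split => //; exact: filterT.
  by move=> [t z] [].
apply: filterS2 hT' hG' => -[t z] /= hT' hG'.
have -> : (\row_i x i t, z) = (x0, z) + \sum_j tau j t *: c j.
  rewrite [LHS](row_pair_expand _ (x^~ 0) _ z) big_sumType/= -/x0; congr (_ + _).
  by rewrite [X in _ + X]big1 ?addr0// => -[] _; rewrite subrr scale0r.
have -> : \sum_j S j t * W j 0%N z = \sum_i (\sum_j l i j * S j t) * G i (x0, z).
  under eq_bigr do rewrite /W /= mulr_sumr.
  rewrite exchange_big; apply: eq_bigr => i _; rewrite mulr_suml.
  by apply: eq_bigr => j _; rewrite mulrCA mulrA.
rewrite -(subrK (\sum_i T i t * G i (x0, z)) (g _)) -addrA -sumrB.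
apply: le_trans (ler_normD _ _) _; apply: lerD => //.
apply: le_trans (ler_norm_sum _ _ _) _; apply: ler_sum => i _.
by rewrite -mulrBl normrM ler_wpM2l.
Qed.

End LocalExpansion.

(** * Independence of the derivative from the representation *)

Section Derivative.
Context (R : realType).

Lemma lo_dist_le (u : R -> R) (eta : R -> R) (C : R) : lo eta ->
  (\forall t \near 0^'+, `|u t| <= eta t * C) -> lo u.
Proof.
move=> leta h; apply: lo_le (loZ C leta) _.
by apply: filterS h => t ht; apply: le_trans ht (ler_norm _).
Qed.

Lemma near_row p (P : set 'rV[R]_p) (x : 'I_p -> R -> R) : open P ->
  (forall i, Ro (x i)) -> P (\row_i x i 0) -> \forall t \near 0^'+, P (\row_i x i t).
Proof.
move=> oP Rx Px; have nP : nbhs (\row_i x i 0, 0 : R) (P `*` setT).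
  apply: open_nbhs_nbhs; split => //; apply: open_setX => //; exact: openT.
have := row_pair_cvg Rx (Ro_const (0 : R)) nP.
by apply: (@filterS R 0^'+) => t [].
Qed.

(** The expansions of both derivatives are integrated from r. By the mean value theorem, al - al'
    minus the integrated expansion changes by lo between r and z; so the integrated expansion is lo
    at each z near r, and [lo_derive] returns to the derivatives at r. *)
Lemma partial2_independent p (P : set 'rV[R]_p) (V : set R) al x
    p' (P' : set 'rV[R]_p') (V' : set R) al' x' (r : R) :
  open P -> open V -> smooth_on (P `*` V) al -> (forall i, Ro (x i)) ->
  P (\row_i x i 0) -> V r ->
  open P' -> open V' -> smooth_on (P' `*` V') al' -> (forall i, Ro (x' i)) ->
  P' (\row_i x' i 0) -> V' r ->
  (\forall z \near r, lo (fun t => al (\row_i x i t, z) - al' (\row_i x' i t, z))) ->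
  lo (fun t => partial2 al' (\row_i x' i t, r)) ->
  lo (fun t => partial2 al (\row_i x i t, r)).
Proof.
move=> oP oV sal Rx Px Vr oP' oV' sal' Rx' Px' Vr' hal hal'.
have sd : smooth_on (P `*` V) (partial2 al) by exact: (smooth_on_iter 1 sal).
have sd' : smooth_on (P' `*` V') (partial2 al') by exact: (smooth_on_iter 1 sal').
have [N [T [W [eta [_ _ leta dW [[A B] /= [hA hB] AB]]]]]] :=
  local_expansion oP oV sd Rx Px Vr.
have [N' [T' [W' [eta' [_ _ leta' dW' [[A' B'] /= [hA' hB'] AB']]]]]] :=
  local_expansion oP' oV' sd' Rx' Px' Vr'.
have nB : nbhs r (B `&` B' `&` (V `&` V') `&`
    [set z | lo (fun t => al (\row_i x i t, z) - al' (\row_i x' i t, z))]).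
  apply: filterI => //; apply: filterI; first exact: filterI.
  by apply: filterI; apply: open_nbhs_nbhs; split.
move: nB => /nbhs_normP[e2 /= e20 he].
(* Half the radius, so that all conditions hold on the closed interval required by
   [antiderivative]. *)
pose e := e2 / 2; have e0 : 0 < e by rewrite divr_gt0.
have {}he z : `|z - r| <= e -> [/\ B z, B' z, V z, V' z &
    lo (fun t => al (\row_i x i t, z) - al' (\row_i x' i t, z))].
  move=> ze; have [|[[? ?] [? ?]] ?] := he z; last by split.
  by rewrite /= distrC; apply: le_lt_trans ze _; rewrite /e; lra.
have cont (w dw : R -> R) (U : set R) :
    (forall z, U z -> is_derive z 1 w (dw z)) -> forall z, U z -> {for z, continuous w}.
  move=> h z Uz; apply/differentiable_continuous/derivable1_diffP.
  by case: (h z Uz).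
have lt_e : r - e < r + e by lra.
have itve z : r - e <= z <= r + e -> `|z - r| <= e by rewrite ler_distl.
have /choice[I hI] : forall i, exists I : R -> R, forall z, r - e < z < r + e ->
    is_derive z 1 I (W i 0%N z).
  move=> i; apply: antiderivative => // z /itve/he[_ _ Vz _ _].
  exact: cont (dW i 0%N) z Vz.
have /choice[I' hI'] : forall i, exists I : R -> R, forall z, r - e < z < r + e ->
    is_derive z 1 I (W' i 0%N z).
  move=> i; apply: antiderivative => // z /itve/he[_ _ _ Vz _].
  exact: cont (dW' i 0%N) z Vz.
(* Both expansions form one family, the second with sign -1. [Z] is normalised to vanish at r; the
   terms [+ 0] in [w] are the derivatives of the subtracted constants. *)
pose S (i : 'I_N + 'I_N') := match i with inl j => T j | inr j => T' j end.
pose Z (i : 'I_N + 'I_N') z := match i with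
  | inl j => I j z + - I j r | inr j => -1 * (I' j z + - I' j r) end.
pose w (i : 'I_N + 'I_N') z := match i with
  | inl j => W j 0%N z + 0 | inr j => -1 * (W' j 0%N z + 0) end.
have dZ i z : r - e < z < r + e -> is_derive z 1 (Z i) (w i z).
  by move=> hz; case: i => j /=; [|apply: is_derive_mulf]; apply: is_derive_addf;
    by [exact: hI|exact: hI'|exact: is_derive_cst].
have Sw t s : \sum_i S i t * w i s = \sum_i T i t * W i 0%N s - \sum_i T' i t * W' i 0%N s.
  rewrite big_sumType/= -sumrN; congr (_ + _); apply: eq_bigr => i _; ring.
have Zr i : Z i r = 0 by case: i => j /=; rewrite subrr ?mulr0.
have nPx := near_row oP Rx Px; have nPx' := near_row oP' Rx' Px'.
have hSZ z : r - e < z < r + e -> lo (fun t => \sum_i S i t * Z i z).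
  move=> zre; have /andP[zr1 zr2] := zre.
  have zr : `|z - r| < e by rewrite ltr_distl.
  pose D t s := al (\row_i x i t, s) + -1 * al' (\row_i x' i t, s).
  pose E t s := D t s + -1 * \sum_i S i t * Z i s.
  pose dE t s := partial2 al (\row_i x i t, s) + -1 * partial2 al' (\row_i x' i t, s) +
    -1 * \sum_i S i t * w i s.
  have lE : lo (fun t => E t z - E t r).
    apply: (@lo_dist_le _ (fun t => eta t + eta' t) `|z - r|); first exact: loD.
    apply: filterS2 (filterI nPx nPx') (filterI hA hA') => t [Pt Pt'] [At At'].
    apply: (@mean_value_dist _ _ (dE t)) => s sz.
      have se : `|s - r| < e by exact: le_lt_trans zr.
      have [_ _ Vs Vs' _] := he s (ltW se).
      apply: is_derive_addf.
        apply: is_derive_addf; first exact: is_derive_snd sal Pt Vs.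
        apply: is_derive_mulf; exact: is_derive_snd sal' Pt' Vs'.
      apply: is_derive_mulf; apply: is_derive_sumf => i; apply: is_derive_mulf.
      by apply: dZ; rewrite -ltr_distl.
    have se : `|s - r| < e by exact: le_lt_trans zr.
    have [Bs Bs' _ _ _] := he s (ltW se).
    have -> : dE t s = (partial2 al (\row_i x i t, s) - \sum_i T i t * W i 0%N s) -
        (partial2 al' (\row_i x' i t, s) - \sum_i T' i t * W' i 0%N s).
      rewrite /dE Sw; ring.
    apply: le_trans (ler_normB _ _) _; apply: lerD.
      exact: (AB (t, s)).
    exact: (AB' (t, s)).
  have [_ _ _ _ hz] := he z (ltW zr).
  have [|_ _ _ _ hr] := he r; first by rewrite subrr normr0 ltW.
  apply: lo_eq (loB (loB hz hr) lE) _; apply: nearW => t; rewrite /E /D.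
  have -> : \sum_i S i t * Z i r = 0 by apply: big1 => i _; rewrite Zr mulr0.
  ring.
have rre : r - e < r < r + e by apply/andP; split; lra.
have hS : lo (fun t => \sum_i S i t * w i r).
  apply: (lo_derive (W := Z)); first by move=> i; exact: dZ.
  apply/nbhs_normP; exists e => //= z; rewrite /= distrC ltr_distl => hz.
  exact: hSZ.
have Br : B r by exact: nbhs_singleton hB.
have Br' : B' r by exact: nbhs_singleton hB'.
have l1 : lo (fun t => partial2 al (\row_i x i t, r) - \sum_i T i t * W i 0%N r).
  apply: lo_le leta _; apply: filterS hA => t At.
  by apply: le_trans (ler_norm _); exact: (AB (t, r)).
have l2 : lo (fun t => partial2 al' (\row_i x' i t, r) - \sum_i T' i t * W' i 0%N r).
  apply: lo_le leta' _; apply: filterS hA' => t At.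
  by apply: le_trans (ler_norm _); exact: (AB' (t, r)).
apply: lo_eq (loD (loB (loD l1 hS) l2) hal') _; apply: nearW => t.
rewrite Sw; ring.
Qed.

End Derivative.

(** * Constancy on the interval *)

Section Constancy.
Context (R : realType).

Lemma repr_FRc (r : R) : repr_of (fun=> r) (FRc r).
Proof. exact: repr_FR_of. Qed.

Lemma st_FRc (r : R) : st (FRc r) = r.
Proof. by rewrite (repr_st (repr_FRc r)). Qed.

Lemma repr_rep (z : FR R) : repr_of (rep z) z.
Proof. by rewrite /rep; case: cid. Qed.

Lemma st_le (x y : FR R) : FR_le x y -> st x <= st y.
Proof.
move=> [xr [yr [z [rx [ry [Rz [[z0 _] [d d0 h]]]]]]]].
rewrite (repr_st rx) (repr_st ry); have := h 0; rewrite lexx d0 => /(_ isT).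
by move: z0; rewrite subr0 => ->; rewrite addr0.
Qed.

Lemma st_lt_FR_lt (x y : FR R) : st x < st y -> FR_lt x y.
Proof.
move=> xy; split; last by move=> E; move: xy; rewrite E ltxx.
exists (rep x), (rep y), (fun=> 0); split; first exact: repr_rep.
split; first exact: repr_rep.
split; first exact: Ro_const.
split; first by split; [rewrite subrr|apply: lo_eq (@lo0 R) _; apply: nearW => t; rewrite subrr].
have hx := Ro_cvg (repr_Ro (repr_rep x)); have hy := Ro_cvg (repr_Ro (repr_rep y)).
have hxy : \forall t \near 0^'+, rep x t < rep y t.
  pose m := (st x + st y) / 2.
  have hm : st x < m < st y by rewrite /m; apply/andP; split; lra.
  have /andP[m1 m2] := hm.
  have h1 : \forall t \near 0^'+, rep x t < m by exact: (cvgr_lt _ hx m m1).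
  have h2 : \forall t \near 0^'+, m < rep y t by exact: (cvgr_gt _ hy m m2).
  by apply: filterS2 h1 h2 => t; exact: lt_trans.
move: hxy => [d /= d0 hd]; exists d => // t /andP[t0 td].
rewrite addr0; move: t0; rewrite le_eqVlt => /predU1P[<-|t0]; first exact: ltW.
by apply/ltW/hd => //=; rewrite sub0r normrN gtr0_norm.
Qed.

(** [ext_eq] provides some representatives; this passes to prescribed ones by [lo_smooth_eval]. *)
Lemma ext_eq_lo p (P : set 'rV[R]_p) (V : set R) al pp (y z : FR R) x yr u :
  open P -> open V -> smooth_on (P `*` V) al -> P (\row_i x i 0) -> V (st y) ->
  (forall i, repr_of (x i) (pp i)) -> repr_of yr y -> repr_of u z ->
  ext_eq al pp y z -> lo (fun t => al (\row_i x i t, yr t) - u t).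
Proof.
move=> oP oV sal Px Vy rx ry ru [x' [yr' [rx' [ry' rz]]]].
have Vy0 : V (yr 0) by rewrite -(repr_st ry).
have l1 := lo_smooth_eval oP oV sal (fun i => repr_Ro (rx i)) (fun i => repr_Ro (rx' i))
  (repr_Ro ry) (repr_Ro ry') (fun i => repr_lo (rx i) (rx' i)) (repr_lo ry ry') Px Vy0.
apply: lo_eq (loD l1 (repr_lo rz ru)) _; apply: nearW => t; ring.
Qed.

Variables (a b : eFR R) (ca cb : bool) (f : FR R -> FR R).
Let S := FR_interval a b ca cb.
Let A := [set z : R | (est a < z%:E)%E /\ (z%:E < est b)%E].
(** The closed bounds are forced even at an open end: a point infinitesimally above [a] has standard
    part [st a]. *)
Let C := [set z : R | (est a <= z%:E)%E /\ (z%:E <= est b)%E].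

Lemma FRc_interval z : A z -> S (FRc z).
Proof.
move=> [az zb]; split.
  case: a az => [a'||] //=; rewrite lte_fin => az.
  have h : FR_lt a' (FRc z) by apply: st_lt_FR_lt; rewrite st_FRc.
  by case: ca => //; case: h.
case: b zb => [b'||] //=; rewrite lte_fin => zb.
have h : FR_lt (FRc z) b' by apply: st_lt_FR_lt; rewrite st_FRc.
by case: cb => //; case: h.
Qed.

Lemma st_interval y : S y -> C (st y).
Proof.
move=> [ay yb]; split.
  case: a ay => [a'||] //=; last by rewrite leNye.
  by rewrite lee_fin; case: ca => [/st_le|[/st_le]].
case: b yb => [b'||] //=; last by rewrite leey.
by rewrite lee_fin; case: cb => [/st_le|[/st_le]].
Qed.

Lemma open_interior : open A.
Proof.
have oa (c : eFR R) : open [set z : R | (est c < z%:E)%E].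
  case: c => [c||].
  - have -> : [set z : R | (est (Defs.EFin c) < z%:E)%E] = [set z | st c < z].
      by apply/seteqP; split => z /=; rewrite lte_fin.
    exact: open_gt.
  - have -> : [set z : R | (est (EPinf R) < z%:E)%E] = set0.
      by apply/seteqP; split => z //=; rewrite ltNge leey.
    exact: open0.
  - have -> : [set z : R | (est (ENinf R) < z%:E)%E] = setT.
      by apply/seteqP; split => z //= _; rewrite ltNyr.
    exact: openT.
have ob (c : eFR R) : open [set z : R | (z%:E < est c)%E].
  case: c => [c||].
  - have -> : [set z : R | (z%:E < est (Defs.EFin c))%E] = [set z | z < st c].
      by apply/seteqP; split => z /=; rewrite lte_fin.
    exact: open_lt.
  - have -> : [set z : R | (z%:E < est (EPinf R))%E] = setT.
      by apply/seteqP; split => z //= _; rewrite ltry.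
    exact: openT.
  - have -> : [set z : R | (z%:E < est (ENinf R))%E] = set0.
      by apply/seteqP; split => z //=; rewrite ltNge leNye.
    exact: open0.
exact: (openI (oa a) (ob b)).
Qed.

Hypothesis ab : (est a < est b)%E.

Lemma interior_nonempty : exists c, A c.
Proof.
rewrite /A; case: a b ab => [a'||] [b'||] //=.
- by rewrite lte_fin => h; exists ((st a' + st b') / 2); rewrite !lte_fin; split; lra.
- by exists (st a' + 1); rewrite lte_fin ltry; split => //; lra.
- by exists (st b' - 1); rewrite lte_fin ltNyr; split => //; lra.
- by exists 0; rewrite ltNyr ltry.
Qed.

Lemma closure_interior y : C y -> closure A y.
Proof.
move=> [ay yb]; have [c [ac cb']] := interior_nonempty.
move=> B /nbhs_normP[e /= e0 hB].
(* Fraction of the way from y towards the interior point c, short enough to stay in the ball of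
   radius e; the [+ 1] guards against c = y. *)
pose l := Num.min 1 (e / 2 / (`|c - y| + 1)).
have n0 : 0 < `|c - y| + 1 by rewrite ltr_wpDl.
have l0 : 0 < l by rewrite lt_min ltr01 divr_gt0// divr_gt0.
have l1 : l <= 1 by rewrite ge_min lexx.
have le : l * (`|c - y| + 1) <= e / 2 by rewrite -ler_pdivlMr// ge_min lexx orbT.
exists (y + l * (c - y)); split; last first.
  apply: hB; rewrite /= opprD addrA subrr sub0r normrN normrM (gtr0_norm l0).
  have : l * `|c - y| <= l * (`|c - y| + 1) by rewrite ler_pM2l// lerDl.
  by move=> ?; lra.
split.
  case: a ay ac => [a'||] //=; last by move=> _ _; rewrite ltNyr.
  rewrite lee_fin !lte_fin => h1 h2.
  have p1 : 0 <= (1 - l) * (y - st a') by rewrite mulr_ge0// subr_ge0.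
  by have p2 : 0 < l * (c - st a'); [rewrite mulr_gt0// subr_gt0|lra].
case: b yb cb' => [b'||] //=; last by move=> _ _; rewrite ltry.
rewrite lee_fin !lte_fin => h1 h2.
have p1 : 0 <= (1 - l) * (st b' - y) by rewrite mulr_ge0// subr_ge0.
by have p2 : 0 < l * (st b' - c); [rewrite mulr_gt0// subr_gt0|lra].
Qed.

Hypothesis smooth_f : FR_smooth S f.
Hypothesis deriv0 : forall x, FR_int a b x -> FR_deriv S f x = FR0 R.

Lemma partial2_lo0 p (P : set 'rV[R]_p) (V : set R) pp al (x0 : FR R) (r : R) :
  local_repr S f x0 V P pp al -> A r -> V r ->
  lo (fun t => partial2 al (\row_i rep (pp i) t, r)).
Proof.
move=> [oV [_ [oP [Pp [sal hal]]]]] Ar Vr.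
have Rpp i : Ro (rep (pp i)) := repr_Ro (repr_rep (pp i)).
have sd : smooth_on (P `*` V) (partial2 al) by exact: (smooth_on_iter 1 sal).
have := deriv0 (x := FRc r); rewrite /FR_int /= st_FRc => /(_ Ar).
(* [FR_deriv] also takes the value [FR0] when no derivative exists; that branch is excluded by
   exhibiting one, the value of [partial2 al] at r. *)
rewrite /FR_deriv; case: pselect => [h|[]]; last first.
  have Rd := Ro_smooth_eval oP oV sd Rpp (Ro_const r) Pp Vr.
  exists (FR_of Rd), V, p, P, pp, al; split; first by rewrite /local_repr st_FRc.
  exists (fun i => rep (pp i)), (fun=> r); split; first by move=> i; exact: repr_rep.
  by split; [exact: repr_FRc|exact: repr_FR_of].
case: cid => d /= hd d0; rewrite {}d0 {d} in hd.
have [V' [p' [P' [pp' [al' [[oV' [Vr' [oP' [Pp' [sal' hal'']]]]] hext]]]]]] := hd.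
have Rpp' i : Ro (rep (pp' i)) := repr_Ro (repr_rep (pp' i)).
have sd' : smooth_on (P' `*` V') (partial2 al') by exact: (smooth_on_iter 1 sal').
have Vr'0 := Vr'; rewrite st_FRc in Vr'0.
apply: (partial2_independent oP oV sal Rpp Pp Vr oP' oV' sal' Rpp' Pp' Vr'0).
  (* Real points near r lie in J, so both representations compute the same [f (FRc z)] there. *)
  have nA : nbhs r (A `&` (V `&` V')).
    by apply: filterI; [|apply: filterI]; apply: open_nbhs_nbhs; split => //; exact: open_interior.
  apply: filterS nA => z [Az [Vz Vz']].
  have Sz := FRc_interval Az; have ru := repr_rep (f (FRc z)).
  have hz := hal _ Sz; have hz' := hal'' _ Sz; rewrite st_FRc in hz hz'.
  have Vsz : V (st (FRc z)) by rewrite st_FRc.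
  have Vsz' : V' (st (FRc z)) by rewrite st_FRc.
  have l1 := ext_eq_lo oP oV sal Pp Vsz (fun i => repr_rep _) (repr_FRc z) ru (hz Vz).
  have l2 := ext_eq_lo oP' oV' sal' Pp' Vsz' (fun i => repr_rep _) (repr_FRc z) ru (hz' Vz').
  apply: lo_eq (loB l1 l2) _; apply: nearW => t; ring.
have := ext_eq_lo oP' oV' sd' Pp' Vr' (fun i => repr_rep _) (repr_FRc r) (repr_FRc 0) hext.
by move=> l; apply: lo_eq l _; apply: nearW => t; rewrite subr0.
Qed.

(** Moving along y_t, [st y], [st x], x_t changes [F] by lo at each stage. The standard parts may
    lie outside J, so there only [F], never [f], is evaluated. *)
Lemma locally_constant (x : FR R) : S x ->
  exists2 e, 0 < e & forall y, S y -> `|st y - st x| < e -> f y = f x.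
Proof.
move=> Sx; have [V [p [P [pp [al lr]]]]] := smooth_f Sx.
have [oV [Vx [oP [Pp [sal hal]]]]] := lr.
have Rpp i : Ro (rep (pp i)) := repr_Ro (repr_rep (pp i)).
have sd : smooth_on (P `*` V) (partial2 al) by exact: (smooth_on_iter 1 sal).
have [N [T [W [eta [RT ind leta dW [[B D] /= [hB hD] BD]]]]]] :=
  local_expansion oP oV sd Rpp Pp Vx.
have nDV : nbhs (st x) (D `&` V) by apply: filterI => //; apply: open_nbhs_nbhs; split.
move: nDV => /nbhs_normP[e /= e0 he].
have {}he s : `|s - st x| < e -> D s /\ V s by move=> se; apply: he; rewrite /= distrC.
pose F t z := al (\row_i rep (pp i) t, z).
have hF : \forall t \near 0^'+, forall s, `|s - st x| < e ->
    is_derive s 1 (F t) (partial2 al (\row_i rep (pp i) t, s)) /\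
    `|partial2 al (\row_i rep (pp i) t, s) - \sum_i T i t * W i 0%N s| <= eta t.
  apply: filterS2 hB (near_row oP Rpp Pp) => t Bt Pt s /he[Ds Vs].
  by split; [exact: is_derive_snd sal Pt Vs|exact: (BD (t, s))].
(* At a fixed r the values of the [W i] are constants in t, so independence makes them vanish
   exactly. *)
have W0 i r : A r -> `|r - st x| < e -> W i 0%N r = 0.
  move=> Ar /he[Dr Vr]; apply: (ind (fun i => W i 0%N r)).
  have l1 : lo (fun t => partial2 al (\row_i rep (pp i) t, r) - \sum_i T i t * W i 0%N r).
    apply: lo_le leta _; apply: filterS hB => t Bt.
    by apply: le_trans (ler_norm _); exact: (BD (t, r)).
  apply: lo_eq (loB (partial2_lo0 lr Ar Vr) l1) _; apply: nearW => t.
  under eq_bigr do rewrite mulrC.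
  ring.
have near_e c : `|c - st x| < e -> \forall z \near c, `|z - st x| < e.
  move=> ce; apply/nbhs_normP; exists (e - `|c - st x|); first by rewrite /= subr_gt0.
  move=> z; rewrite /= ltrBrDr => hz; apply: le_lt_trans hz.
  by rewrite (distrC c z) -(subrKA c); exact: ler_normD.
have W1 i c : C c -> `|c - st x| < e -> W i 0%N c = 0.
  move=> Cc ce; have [_ Vc] := he c ce.
  apply: (continuous_closure_eq0 (w := W i 0%N) _ (closure_interior Cc)).
    apply/differentiable_continuous/derivable1_diffP.
    by case: (dW i 0%N c Vc).
  by apply: filterS (near_e c ce) => z ze Az; exact: W0.
(* The segment from [st y] to [rep y t] may leave [A]. Flatness of order n, where n is a nilpotency
   exponent of [rep y t - st y], bounds the [W i] on it by a lo function. *)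
have shift y : S y -> `|st y - st x| < e -> lo (fun t => F t (rep y t) - F t (st y)).
  move=> Sy ye; have Ry := repr_Ro (repr_rep y).
  have [cvy [n hn]] := Ro_nilpotent Ry.
  have [_ Vy] := he _ ye.
  have clA := closure_interior (st_interval Sy).
  have /choice[K hK] : forall i, exists K,
      \forall z \near st y, `|W i 0%N z| <= K * `|z - st y| ^+ n.
    move=> i; apply: (flat_bound n open_interior clA).
      move=> k; have nV : nbhs (st y) V by apply: open_nbhs_nbhs; split.
      by apply: filterS nV => z Vz; exact: dW.
    by apply: filterS (near_e _ ye) => z ze Az; exact: W0.
  have /choice[M hM] := fun i => Ro_bounded (RT i).
  have nK : nbhs (st y) (fun z => `|z - st x| < e /\
      forall i, `|W i 0%N z| <= K i * `|z - st y| ^+ n).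
    apply: filterI; first exact: near_e.
    exact: (@filter_forall R 'I_N (fun i z => `|W i 0%N z| <= K i * `|z - st y| ^+ n)
      (nbhs (st y)) _ hK).
  move: nK => /nbhs_normP[e1 /= e10 he1].
  pose eta2 t := eta t + \sum_i (`|rep y t - st y| ^+ n) * (M i * `|K i|).
  have leta2 : lo eta2.
    apply: loD => //; apply: lo_sum => i; apply: loZ.
    by apply: lo_le hn _; apply: nearW => t; rewrite -normrX normr_id.
  have nM : \forall t \near 0^'+, forall i, `|T i t| <= M i.
    exact: (@filter_forall R 'I_N (fun i t => `|T i t| <= M i) 0^'+ _ hM).
  (* The 1 absorbs the factor |rep y t - st y| left by the mean value estimate. *)
  have m0 : 0 < Num.min e1 1 by rewrite lt_min e10 ltr01.
  have ny : \forall t \near 0^'+, `|rep y t - st y| < Num.min e1 1.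
    move/cvgrPdist_lt : cvy => /(_ _ m0); apply: filterS => t.
    by rewrite sub0r normrN.
  apply: (@lo_dist_le _ _ eta2 1) => //.
  apply: filterS2 hF (filterI nM ny) => t hFt [Mt]; rewrite lt_min => /andP[yt1 yt2].
  have H : `|F t (rep y t) - F t (st y)| <= eta2 t * `|rep y t - st y|.
    have hs s : `|s - st y| <= `|rep y t - st y| -> `|s - st x| < e /\
        forall i, `|W i 0%N s| <= K i * `|s - st y| ^+ n.
      by move=> sy; apply: he1; rewrite /= distrC; exact: le_lt_trans yt1.
    apply: (@mean_value_dist R (F t) (fun s => partial2 al (\row_i rep (pp i) t, s)))
      => s sy; have [se Ws] := hs s sy.
      by have [] := hFt s se.
    have [_ bs] := hFt s se.
    rewrite -(subrK (\sum_i T i t * W i 0%N s) (partial2 al _)).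
    apply: le_trans (ler_normD _ _) _; apply: lerD => //.
    apply: le_trans (ler_norm_sum _ _ _) _; apply: ler_sum => i _.
    rewrite normrM [leRHS]mulrC -mulrA; apply: ler_pM => //.
    apply: le_trans (Ws i) _; apply: (@le_trans _ _ (`|K i| * `|s - st y| ^+ n)).
      by rewrite ler_wpM2r ?exprn_ge0// ler_norm.
    by rewrite ler_wpM2l// lerXn2r ?nnegrE.
  apply: le_trans H _; apply: ler_wpM2l; last exact: ltW.
  rewrite addr_ge0//.
    have [_] := hFt _ ye; exact: le_trans.
  apply: sumr_ge0 => i _; rewrite mulr_ge0 ?exprn_ge0// mulr_ge0//.
  by apply: le_trans (Mt i).
(* Between real points of [C] the segment stays in [C], where the [W i] vanish, so only the uniform
   error [eta] remains. *)
have line c1 c2 : c1 <= c2 -> C c1 -> C c2 -> `|c1 - st x| < e -> `|c2 - st x| < e ->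
    lo (fun t => F t c2 - F t c1).
  move=> c12 [C1 _] [_ C2] c1e c2e.
  apply: (@lo_dist_le _ _ eta (c2 - c1)) => //.
  apply: filterS hF => t hFt.
  have hs s : c1 <= s <= c2 -> C s /\ `|s - st x| < e.
    move=> /andP[s1 s2]; split.
      by split; [apply: le_trans C1 _|apply: le_trans C2]; rewrite lee_fin.
    move: c1e c2e; rewrite !ltr_norml => /andP[? ?] /andP[? ?]; apply/andP; split; lra.
  apply: (@mean_value_le R (F t) (fun s => partial2 al (\row_i rep (pp i) t, s)))
    => // s /hs[Cs se]; have [ds bs] := hFt s se; first exact: ds.
  by move: bs; rewrite big1 ?subr0// => i _; rewrite W1// mulr0.
exists e => // y Sy ye.
have xe : `|st x - st x| < e by rewrite subrr normr0.
have Cx := st_interval Sx; have Cy := st_interval Sy.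
have [_ Vy] := he _ ye.
have l1 := ext_eq_lo oP oV sal Pp Vy (fun i => repr_rep _)
  (repr_rep y) (repr_rep (f y)) (hal y Sy Vy).
have l2 := ext_eq_lo oP oV sal Pp Vx (fun i => repr_rep _)
  (repr_rep x) (repr_rep (f x)) (hal x Sx Vx).
have l3 := shift y Sy ye; have l4 := shift x Sx xe.
have l5 : lo (fun t => F t (st y) - F t (st x)).
  have [xy|/ltW yx] := leP (st x) (st y); first exact: line.
  by apply: lo_eq (loN (line _ _ yx Cy Cx ye xe)) _; apply: nearW => t; rewrite opprB.
apply: (repr_eq (repr_rep (f y)) (repr_rep (f x))).
apply: lo_eq (loB (loD (loB (loD l3 l5) l4) l2) l1) _; apply: nearW => t.
rewrite /F; ring.
Qed.

Lemma constant_on_interval x y : S x -> S y -> f x = f y.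
Proof.
(* Every value of [f] is taken at a real interior point, so it is enough to compare two of those. *)
suff H : forall x, S x -> exists2 c, A c & f (FRc c) = f x.
  move=> Sx Sy; have [c Ac <-] := H x Sx; have [d Ad <-] := H y Sy.
  wlog cd : c d Ac Ad / c <= d.
    by move=> W; have [/W|/ltW/W] := leP c d; [|move/(_ Ad Ac)/esym]; exact.
  (* Connectedness of [c, d] by calculus: this 0/1 indicator is locally constant, so it has
     derivative 0, and the mean value bound with constant 0 gives g d = g c = 0. *)
  pose g z : R := if `[< f (FRc z) = f (FRc c) >] then 0 else 1.
  have dg z : c <= z <= d -> is_derive (z : R) 1 g 0.
    move=> /andP[cz zd]; have Az : A z.
      move: Ac Ad => [ac _] [_ bd]; split.
        by apply: lt_le_trans ac _; rewrite lee_fin.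
      by apply: le_lt_trans bd; rewrite lee_fin.
    apply: near_eq_is_derive (is_derive_cst (g z) z 1).
    have [e e0 he] := locally_constant (FRc_interval Az).
    have nA : nbhs z (A `&` [set w | `|w - z| < e]).
      apply: filterI; first by apply: open_nbhs_nbhs; split => //; exact: open_interior.
      by apply/nbhs_normP; exists e => //= w; rewrite /= distrC.
    apply: filterS nA => w [Aw we]; rewrite /g (he (FRc w))//; first exact: FRc_interval.
    by rewrite !st_FRc.
  have b0 s : c <= s <= d -> `|0 : R| <= 0 by rewrite normr0.
  have := mean_value_le cd dg b0.
  rewrite mul0r normr_le0 subr_eq0 /g (asboolT (erefl (f (FRc c)))); case: asboolP => [-> //|_].
  by rewrite oner_eq0.
move=> {x y} x Sx; have [e e0 he] := locally_constant Sx.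
have nb : nbhs (st x) [set z | `|z - st x| < e].
  by apply/nbhs_normP; exists e => //= z; rewrite /= distrC.
have [c [Ac ce]] := closure_interior (st_interval Sx) nb.
by exists c => //; apply: he; [exact: FRc_interval|rewrite st_FRc].
Qed.

End Constancy.

Theorem theorem7 (R : realType) (a b : eFR R) (ca cb : bool)
  (f : FR R -> FR R) :
  eFR_le a b ->
  (est a < est b)%E ->
  FR_smooth (FR_interval a b ca cb) f ->
  (forall x, FR_int a b x -> FR_deriv (FR_interval a b ca cb) f x = FR0 R) ->
  forall x y, FR_interval a b ca cb x -> FR_interval a b ca cb y -> f x = f y.
Proof.
move=> _ ab smooth_f deriv0 x y Sx Sy.
exact: (constant_on_interval ab smooth_f deriv0 Sx Sy).
Qed.
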